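(* Let $F$ be a formally real field and let $(A,\sigma)$ be a decomposable central simple $F$-algebra with involution of the first kind. The following statements are equivalent: (i) $(A,\sigma)$ is weakly isotropic; (ii) $(A,\sigma)$ is weakly hyperbolic; (iii) the quadratic form $T_\sigma$ is weakly isotropic; (iv) the quadratic form $T_\sigma$ is weakly hyperbolic; (v) $\mathrm{sig}_P\,\sigma=0$ for all orderings $P$ on $F$; (vi) $\mathrm{sig}_P\, T_\sigma=0$ for all orderings $P$ on $F$.
   Context: Let $A$ be a central simple $F$-algebra with an involution $\sigma$ of the first kind (i.e. $\sigma$ is an $F$-linear anti-automorphism of $A$ with $\sigma^2=\mathrm{id}$). $(A,\sigma)$ is decomposable if it can be written as $$(A,\sigma)\cong (Q_1,\sigma_1)\otimes_F\cdots\otimes_F (Q_r,\sigma_r)\otimes_F (M_s(F),t)$$ for certain quaternion division $F$-algebras $Q_i$ with involution of the first kind $\sigma_i$, $1\leq i\leq r$, and $s\geq 1$, where $t$ denotes the transpose involution. $(A,\sigma)$ is weakly isotropic if there exist finitely many nonzero elements $x_1,\ldots,x_n\in A$ (for some $n\geq 1$) with $\sigma(x_1)x_1+\cdots+\sigma(x_n)x_n=0$. $(A,\sigma)$ is hyperbolic if $\sigma$ is the adjoint involution of a hyperbolic hermitian or skew-hermitian form over the division algebra (with involution of the first kind) Brauer equivalent to $A$; equivalently, if there is a nonzero idempotent $e\in A$ with $\sigma(e)=1-e$. $(A,\sigma)$ is weakly hyperbolic if there exists a positive integer $n$ such that $(M_n(F),t)\otimes_F(A,\sigma)$ is hyperbolic.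 The involution trace form $T_\sigma$ of $(A,\sigma)$ is the quadratic form on the $F$-vector space $A$ defined by $T_\sigma(x):=\mathrm{Trd}_A(\sigma(x)x)$ for all $x\in A$, where $\mathrm{Trd}_A$ is the reduced trace of $A$. A quadratic form $\varphi$ over $F$ is weakly isotropic (resp. weakly hyperbolic) if there is a positive integer $n$ such that the $n$-fold orthogonal sum $\varphi\perp\cdots\perp\varphi$ is isotropic (resp. hyperbolic). For an ordering $P$ on $F$, $\mathrm{sig}_P\, q$ denotes the signature of a quadratic form $q$ at $P$, and the signature of the involution $\sigma$ at $P$ is $\mathrm{sig}_P\,\sigma:=\sqrt{\mathrm{sig}_P\, T_\sigma}$. *)

(* Defs.v *)
From HB Require Import structures.
From mathcomp Require Import all_boot all_order all_algebra all_field.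
From mathcomp Require Import boolp classical_sets.

Set Implicit Arguments.
Unset Strict Implicit.
Unset Printing Implicit Defensive.

Import Order.TTheory GRing.Theory Num.Theory.
Import VectorInternalTheory.
Local Open Scope ring_scope.

Declare Scope alginv_scope.
Delimit Scope alginv_scope with ALG.

(* [A (x) B] is realised on coordinate matrices: the pure tensor [a (x) b] is
   the outer product of the coordinate vectors of [a] and [b].  It carries the
   usual product: (a (x) b)(a' (x) b') = (aa') (x) (bb'), see [tensM]. *)
Definition tens (F : fieldType) (A B : falgType F) : Type :=
  'M[F]_(dim A, dim B).

HB.instance Definition _ (F : fieldType) (A B : falgType F) :=
  Vector.on (tens A B).

Section Tensor.
Variables (F : fieldType) (A B : falgType F).

Definition ptens (a : A) (b : B) : tens A B := (v2r a)^T *m v2r b.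

Fact ptens_linearl b : linear (ptens^~ b).
Proof. by move=> k a a'; rewrite /ptens !linearP /= mulmxDl scalemxAl. Qed.

Fact ptens_linearr a : linear (ptens a).
Proof. by move=> k b b'; rewrite /ptens linearP /= mulmxDr scalemxAr. Qed.

Definition tbasis (V : vectType F) (i : 'I_(dim V)) : V := r2v (delta_mx 0 i).
Arguments tbasis : clear implicits.

Lemma tbasisE (V : vectType F) (v : V) : v = \sum_i v2r v 0 i *: tbasis V i.
Proof.
rewrite -{1}[v]v2rK {1}[v2r v]row_sum_delta linear_sum.
by apply: eq_bigr => i _; rewrite linearZ.
Qed.

(* The linear map on [A (x) B] induced by a bilinear map. *)
Definition tlift (V : lmodType F) (f : A -> B -> V) (x : tens A B) : V :=
  \sum_i \sum_j (x : 'M[F]_(dim A, dim B)) i j *: f (tbasis A i) (tbasis B j).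

Fact tlift_linear (V : lmodType F) (f : A -> B -> V) : linear (tlift f).
Proof.
move=> k x y; rewrite /tlift scaler_sumr -big_split; apply: eq_bigr => i _ /=.
rewrite scaler_sumr -big_split; apply: eq_bigr => j _ /=.
by rewrite !mxE scalerDl scalerA.
Qed.

Lemma tlift_ptens (V : lmodType F) (f : A -> B -> V) :
  (forall b, linear (f^~ b)) -> (forall a, linear (f a)) ->
  forall a b, tlift f (ptens a b) = f a b.
Proof.
move=> fl fr a b.
pose Ll b := GRing.isLinear.Build F A V *:%R (f^~ b) (fl b).
pose fl' b : {linear A -> V} := HB.pack (f^~ b) (Ll b).
pose Lr a := GRing.isLinear.Build F B V *:%R (f a) (fr a).
pose fr' a : {linear B -> V} := HB.pack (f a) (Lr a).
rewrite {2}[a]tbasisE -[RHS]/(fl' b _) linear_sum; apply: eq_bigr => i _.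
rewrite linearZ /= {2}[b]tbasisE -[f _ _]/(fr' (tbasis A i) _) linear_sum.
rewrite scaler_sumr; apply: eq_bigr => j _.
by rewrite linearZ /= scalerA !mxE big_ord1 !mxE.
Qed.

Lemma tens_ind (P : tens A B -> Prop) :
  (forall a b, P (ptens a b)) -> (forall x y, P x -> P y -> P (x + y)) ->
  forall x, P x.
Proof.
move=> Pp PD x.
have P0 : P 0 by have := Pp 0 0; rewrite /ptens !linear0.
rewrite (_ : x = \sum_i \sum_j
    ptens ((x : 'M[F]_(dim A, dim B)) i j *: tbasis A i) (tbasis B j)).
  elim/big_ind: _ => // i _; elim/big_ind: _ => // j _; exact: Pp.
rewrite [LHS]matrix_sum_delta; apply: eq_bigr => i _; apply: eq_bigr => j _.
rewrite /ptens /tbasis linearZ /= !r2vK linearZ /= -scalemxAl trmx_delta.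
by rewrite mul_delta_mx.
Qed.

Definition tens_one : tens A B := ptens 1 1.

Definition tens_mul (x y : tens A B) : tens A B :=
  tlift (fun a b => tlift (fun a' b' => ptens (a * a') (b * b')) y) x.

Fact tens_mulDl : left_distributive tens_mul +%R.
Proof.
move=> x y z; rewrite /tens_mul; set f := (fun a b => _).
by have := tlift_linear f 1 x y; rewrite !scale1r.
Qed.

Fact tens_mulDr : right_distributive tens_mul +%R.
Proof.
move=> x y z; rewrite /tens_mul /tlift -big_split; apply: eq_bigr => i _ /=.
rewrite -big_split; apply: eq_bigr => j _ /=; rewrite -scalerDr; congr (_ *: _).
by have := tlift_linear (fun a' b' => ptens (tbasis A i * a') (tbasis B j * b'))
  1 y z; rewrite !scale1r.
Qed.

Fact tens_scalerAl k (x y : tens A B) :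
  k *: tens_mul x y = tens_mul (k *: x) y.
Proof.
rewrite /tens_mul; set f := (fun a b => _).
have f0 : tlift f 0 = 0.
  by rewrite /tlift !big1 // => i _; rewrite big1 // => j _; rewrite mxE scale0r.
by have := tlift_linear f k x 0; rewrite f0 !addr0.
Qed.

Fact tens_scalerAr k (x y : tens A B) :
  k *: tens_mul x y = tens_mul x (k *: y).
Proof.
rewrite /tens_mul /tlift scaler_sumr; apply: eq_bigr => i _.
rewrite scaler_sumr; apply: eq_bigr => j _.
rewrite scalerA mulrC -scalerA; congr (_ *: _).
rewrite scaler_sumr; apply: eq_bigr => i' _.
by rewrite scaler_sumr; apply: eq_bigr => j' _; rewrite !mxE scalerA.
Qed.

Lemma tens_mul_ptens a b a' b' :
  tens_mul (ptens a b) (ptens a' b') = ptens (a * a') (b * b').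
Proof.
have E c d : tlift (fun a' b' => ptens (c * a') (d * b')) (ptens a' b') =
             ptens (c * a') (d * b').
  rewrite tlift_ptens // => [y|x] k u v.
    by rewrite mulrDr -scalerAr ptens_linearl.
  by rewrite mulrDr -scalerAr ptens_linearr.
rewrite /tens_mul tlift_ptens ?E // => [y|x] k u v; rewrite !E.
  by rewrite mulrDl -scalerAl ptens_linearl.
by rewrite mulrDl -scalerAl ptens_linearr.
Qed.

Fact tens_mulA : associative tens_mul.
Proof.
move=> x y z; elim/tens_ind: x => [a b|x x' IH IH']; last first.
  by rewrite !tens_mulDl IH IH'.
elim/tens_ind: y => [a' b'|y y' IH IH']; last first.
  by rewrite tens_mulDl !tens_mulDr tens_mulDl IH IH'.
elim/tens_ind: z => [c d|z z' IH IH']; last by rewrite !tens_mulDr IH IH'.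
by rewrite !tens_mul_ptens !mulrA.
Qed.

Fact tens_mul1r : left_id tens_one tens_mul.
Proof.
elim/tens_ind => [a b|x y IH IH']; last by rewrite tens_mulDr IH IH'.
by rewrite tens_mul_ptens !mul1r.
Qed.

Fact tens_mulr1 : right_id tens_one tens_mul.
Proof.
elim/tens_ind => [a b|x y IH IH']; last by rewrite tens_mulDl IH IH'.
by rewrite tens_mul_ptens !mulr1.
Qed.

Fact tens_one_neq0 : tens_one != 0.
Proof.
have nz (C : falgType F) : exists i, v2r (1 : C) 0 i != 0.
  apply/existsP; apply: contraNT (oner_neq0 C) => /existsPn nz.
  rewrite -(inj_eq (@v2r_inj _ _)) linear0; apply/eqP/rowP => i.
  by have /negPn/eqP := nz i; rewrite mxE.
have [i ai] := nz A; have [j bj] := nz B.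
apply: contraNneq (mulf_neq0 ai bj) => /matrixP/(_ i j).
by rewrite !mxE big_ord1 !mxE => ->.
Qed.

HB.instance Definition _ := GRing.Zmodule_isNzRing.Build (tens A B)
  tens_mulA tens_mul1r tens_mulr1 tens_mulDl tens_mulDr tens_one_neq0.
HB.instance Definition _ :=
  GRing.Lmodule_isLalgebra.Build F (tens A B) tens_scalerAl.
HB.instance Definition _ :=
  GRing.Lalgebra_isAlgebra.Build F (tens A B) tens_scalerAr.
HB.instance Definition _ := Algebra_isFalgebra.Build F (tens A B).

Lemma tensM a b a' b' : ptens a b * ptens a' b' = ptens (a * a') (b * b').
Proof. exact: tens_mul_ptens. Qed.

Lemma tens1 : 1 = ptens 1 1 :> tens A B. Proof. by []. Qed.

End Tensor.

Record involution (F : fieldType) (A : falgType F) := Involution {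
  inv_fun :> {linear A -> A};
  invM : forall x y, inv_fun (x * y) = inv_fun y * inv_fun x;
  invK : involutive inv_fun }.

Record algInv (F : fieldType) := AlgInv {
  alg :> falgType F;
  inv : involution alg }.

Definition central (F : fieldType) (A : falgType F) : Prop :=
  forall z : A, (forall x, z * x = x * z) -> exists c : F, z = c%:A.

(* A two-sided ideal of a unital algebra is automatically a subspace. *)
Definition simple_alg (F : fieldType) (A : falgType F) : Prop :=
  forall I : {vspace A},
    (forall x y, y \in I -> (x * y \in I) /\ (y * x \in I)) ->
    I = 0%VS \/ I = fullv.

Definition central_simple (F : fieldType) (A : falgType F) : Prop :=
  central A /\ simple_alg A.

Section TensorInvolution.
Variables (F : fieldType) (A B : falgType F).
Variables (sigma : involution A) (tau : involution B).

Definition tens_inv_fun : tens A B -> tens A B :=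
  tlift (fun a b => ptens (sigma a) (tau b)).

HB.instance Definition _ := GRing.isLinear.Build F (tens A B) (tens A B) *:%R
  tens_inv_fun (tlift_linear _).

Lemma tens_invE a b : tens_inv_fun (ptens a b) = ptens (sigma a) (tau b).
Proof.
rewrite /tens_inv_fun tlift_ptens // => [y|x] k u v.
  by rewrite linearP ptens_linearl.
by rewrite linearP ptens_linearr.
Qed.

Fact tens_invM x y :
  tens_inv_fun (x * y) = tens_inv_fun y * tens_inv_fun x.
Proof.
elim/tens_ind: x => [a b|x x' IH IH']; last first.
  by rewrite mulrDl !linearD /= mulrDr IH IH'.
elim/tens_ind: y => [a' b'|y y' IH IH']; last first.
  by rewrite mulrDr !linearD /= mulrDl IH IH'.
by rewrite tensM !tens_invE !invM tensM.
Qed.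

Fact tens_invK : involutive tens_inv_fun.
Proof.
elim/tens_ind => [a b|x y IH IH']; last by rewrite !linearD /= IH IH'.
by rewrite !tens_invE !invK.
Qed.

Definition tens_inv : involution (tens A B) :=
  Involution (inv_fun := tens_inv_fun) tens_invM tens_invK.

End TensorInvolution.

Definition tensor (F : fieldType) (X Y : algInv F) : algInv F :=
  AlgInv (tens_inv (inv X) (inv Y)).

Notation "X '(x)' Y" := (tensor X Y)
  (at level 40, left associativity) : alginv_scope.

Section Transpose.
Variables (F : fieldType) (n : nat).

Fact trmx_invM (x y : 'M[F]_n.+1) : (x * y)^T = y^T * x^T.
Proof. exact: trmx_mul. Qed.

Definition trmx_inv : involution 'M[F]_n.+1 :=
  Involution (inv_fun := @trmx F n.+1 n.+1) trmx_invM (@trmxK F n.+1 n.+1).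

Definition mat_inv : algInv F := AlgInv trmx_inv.

End Transpose.

Definition alginv_iso (F : fieldType) (X Y : algInv F) : Prop :=
  exists f : {lrmorphism X -> Y},
    bijective f /\ (forall x, f (inv X x) = inv Y (f x)).

(* [Q] is a quaternion algebra (a, b)_F (used in characteristic not 2 only). *)
Definition quaternion (F : fieldType) (Q : falgType F) : Prop :=
  exists (a b : F) (i j : Q),
    [/\ a != 0, b != 0,
        [/\ i * i = a%:A, j * j = b%:A & j * i = - (i * j)]
      & basis_of fullv [:: 1; i; j; i * j]].

Definition division_alg (F : fieldType) (A : falgType F) : Prop :=
  forall x : A, x != 0 -> x \is a GRing.unit.

(* [r] may be 0, and the matrix factor has arbitrary positive degree [s.+1].
   The iterated product is Q_0 (x) (Q_1 (x) ... (Q_(r-1) (x) M_(s+1)(F))). *)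
Definition decomposable (F : fieldType) (X : algInv F) : Prop :=
  exists (r : nat) (Q : 'I_r -> algInv F) (s : nat),
    (forall i, quaternion (Q i) /\ division_alg (Q i)) /\
    alginv_iso X (\big[@tensor F/mat_inv F s]_(i < r) Q i).

Definition inv_weakly_isotropic (F : fieldType) (X : algInv F) : Prop :=
  exists (n : nat) (x : 'I_n.+1 -> X),
    (forall i, x i != 0) /\ \sum_i inv X (x i) * x i = 0.

Definition inv_hyperbolic (F : fieldType) (X : algInv F) : Prop :=
  exists e : X, [/\ e != 0, e * e = e & inv X e = 1 - e].

Definition inv_weakly_hyperbolic (F : fieldType) (X : algInv F) : Prop :=
  exists n : nat, inv_hyperbolic (mat_inv F n (x) X)%ALG.

(* [phi] is an F-algebra morphism A -> M_(n+1)(K) sending an F-basis of A to a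
   K-basis of M_(n+1)(K): its K-linear extension A (x)_F K -> M_(n+1)(K) is an
   isomorphism. *)
Definition splitting (F : fieldType) (A : falgType F) (K : fieldType)
    (iota : {rmorphism F -> K}) (n : nat)
    (phi : {lrmorphism A -> 'M[K]_n.+1 | iota \; *:%R}) : Prop :=
  basis_of fullv [seq phi a | a <- vbasis {:A}].

(* The value is the element of F mapped to the trace of [a] in a splitting; for
   a central simple algebra it exists and depends on no choice. *)
Definition Trd (F : fieldType) (A : falgType F) (a : A) : F :=
  xget 0 (fun t : F => exists (K : fieldType) (iota : {rmorphism F -> K})
    (n : nat) (phi : {lrmorphism A -> 'M[K]_n.+1 | iota \; *:%R}),
    splitting phi /\ iota t = \tr (phi a)).

Definition trace_form (F : fieldType) (X : algInv F) (x : X) : F :=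
  Trd (inv X x * x).

Section QuadraticForms.
Variable F : fieldType.

Definition isometric (V W : vectType F) (q : V -> F) (q' : W -> F) : Prop :=
  exists f : {linear V -> W}, bijective f /\ forall v, q' (f v) = q v.

Definition diag_form (n : nat) (a : 'I_n -> F) (v : 'rV[F]_n) : F :=
  \sum_i a i * v 0 i ^+ 2.

(* the orthogonal sum of m hyperbolic planes (x, y) |-> xy *)
Definition hyp_form (m : nat) (v : 'rV[F]_m * 'rV[F]_m) : F :=
  \sum_i v.1 0 i * v.2 0 i.

Definition ntimes (V : vectType F) (n : nat) (q : V -> F)
    (v : {ffun 'I_n -> V}) : F :=
  \sum_i q (v i).

Definition isotropic (V : vectType F) (q : V -> F) : Prop :=
  exists2 v : V, v != 0 & q v = 0.

Definition hyperbolic (V : vectType F) (q : V -> F) : Prop :=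
  exists m : nat, isometric q (@hyp_form m).

Definition weakly_isotropic (V : vectType F) (q : V -> F) : Prop :=
  exists n : nat, isotropic (@ntimes V n.+1 q).

Definition weakly_hyperbolic (V : vectType F) (q : V -> F) : Prop :=
  exists n : nat, hyperbolic (@ntimes V n.+1 q).

Definition formally_real : Prop :=
  forall s : seq F, \sum_(x <- s) x ^+ 2 != -1.

(* An ordering, given by the set of its nonnegative elements. *)
Record ordering := Ordering {
  nonneg :> {pred F};
  nonnegD : forall x y, x \in nonneg -> y \in nonneg -> x + y \in nonneg;
  nonnegM : forall x y, x \in nonneg -> y \in nonneg -> x * y \in nonneg;
  nonneg_total : forall x, (x \in nonneg) || (- x \in nonneg);
  nonneg_anti : forall x, x \in nonneg -> - x \in nonneg -> x = 0 }.

(* The number of positive minus the number of negative entries in a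
   diagonalization of [q]; independent of its choice by Sylvester's law. *)
Definition signature (P : ordering) (V : vectType F) (q : V -> F) : int :=
  xget 0 (fun z : int => exists (n : nat) (a : 'I_n -> F),
    isometric q (diag_form a) /\
    z = #|[pred i | (a i != 0) && (a i \in nonneg P)]|%:Z
        - #|[pred i | (a i != 0) && (- a i \in nonneg P)]|%:Z).

(* sig_P T_sigma is a nonnegative integer; its square root is taken in algC. *)
Definition inv_signature (P : ordering) (X : algInv F) : algC :=
  sqrtC (signature P (@trace_form F X))%:~R.

End QuadraticForms.

(* Main.v *)
From HB Require Import structures.
From mathcomp Require Import all_boot all_order all_algebra all_field.
From mathcomp Require Import boolp classical_sets.
From mathcomp Require Import mxtens.
From mathcomp Require Import ring.
Require Import Defs.

(** In a decomposable algebra with involution everything is controlled by one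
    Pfister form. A quaternion division algebra with involution has a basis
    [1, u, v, uv] of eigenvectors of the involution with [u] and [v]
    anticommuting ([adapted_quat_basis]); on it, [sigma(x)x] takes the values
    [1, c, d, cd] for two scalars [c] and [d]. Tensoring these bases with matrix
    units gives a basis of [A] which is orthogonal for the trace form and on
    which the trace form takes, up to a positive rational constant, the values
    of the Pfister form [<<c1, d1>> ... <<cr, dr>>], where [<<c>> = <1, c>]
    ([decomposable_pfister], [Trd_pf], [trace_formE]). Every coefficient of this
    Pfister form is of the form [sigma(g)g]. At an ordering [P] there are two
    cases: all coefficients are positive, and then no multiple of the trace form
    is isotropic; or the signs cancel, and then the signature is 0. This is why
    weak isotropy of the trace form makes all signatures vanish
    ([isotropic_signature]).

    To go back, consider the set [S] of the multipliers of similitudes of the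
    hermitian forms [<1, ..., 1>] of dimension a power of 2 over [A]. Like the
    set of values of all multiples of a Pfister form, [S] is closed under addition
    and multiplication and contains the squares, and it contains the
    coefficients above. If [-1] were not in [S], then [S] would be a
    preordering, hence contained in the nonnegative cone of some ordering, by
    Zorn's lemma ([preordering_extends]); at that ordering the trace form would
    be positive definite, with nonzero signature ([signature_multiplier]). So
    when all signatures vanish there is a matrix [W] over [A] with
    [W^* W = W W^* = -1]. All the remaining statements are read off from [W]:

    - [u = [0, W; - W^*, 0]] satisfies [u^* = - u] and [u^2 = 1], so that
      [e = (1 + u) / 2] is an idempotent with [e^* = 1 - e], and the involution
      is weakly hyperbolic ([multiplier_weakly_hyperbolic]);
    - a column of such an [e] is an isotropic vector, as
      [e^* e = (1 - e) e = 0], and the involution is weakly isotropic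
      ([weakly_hyperbolic_isotropic]);
    - [W] maps a multiple [q] of the trace form to [- q], so that
      [q(x) + q(y) = q(x) - q(W y)] is hyperbolic
      ([ntimes_trace_form_hyperbolic]).

    Since the reduced trace is defined through an arbitrary splitting, it has to
    be computed: a linear functional vanishing on commutators is determined on
    [A] by its value at 1, which fixes the trace in any matrix representation
    ([rep_trace]); and a representation of the right degree is automatically a
    splitting, because the trace form of the basis is nondegenerate
    ([rep_splitting]). *)

Set Implicit Arguments.
Unset Strict Implicit.
Unset Printing Implicit Defensive.

Import Order.TTheory GRing.Theory Num.Theory.
Import VectorInternalTheory.
Local Open Scope ring_scope.

(** * Preorderings, orderings and signs *)

Section Orderings.
Variable F : fieldType.

Definition preordering (S : F -> Prop) : Prop :=
  [/\ forall x y, S x -> S y -> S (x + y),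
      forall x y, S x -> S y -> S (x * y),
      forall x, S (x ^+ 2) & ~ S (-1)].

(** If [-1 = a + x b] with [a] and [b] in [S], then [b] is nonzero and
    [- x = (1 + a) b b^-2] lies in [S]. *)
Lemma preordering_adjoin (S : F -> Prop) (x : F) :
  preordering S -> ~ S (- x) ->
  preordering (fun y => exists a b, [/\ S a, S b & y = a + x * b]).
Proof.
move=> [SD SM S2 SN1] SNx; split.
- move=> _ _ [a [b [Sa Sb ->]]] [c [d [Sc Sd ->]]].
  exists (a + c), (b + d); split; [exact: SD|exact: SD|ring].
- move=> _ _ [a [b [Sa Sb ->]]] [c [d [Sc Sd ->]]].
  exists (a * c + x ^+ 2 * (b * d)), (a * d + b * c).
  by split; [apply: SD; apply: (SM) => //; exact: SM|apply: SD; exact: SM|ring].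
- move=> y; exists (y ^+ 2), (0 ^+ 2); split=> //; ring.
- move=> [a [b [Sa Sb E]]]; have S1 : S 1 by rewrite -(expr1n F 2).
  have [b0|b0] := eqVneq b 0; first by apply: SN1; rewrite E b0 mulr0 addr0.
  apply: SNx; have -> : - x = (1 + a) * b * b^-1 ^+ 2.
    have -> : 1 + a = - x * b by rewrite -[1]opprK E; ring.
    by field.
  by apply: (SM) => //; apply: (SM) => //; exact: SD.
Qed.

(** Zorn's lemma is applied to the sets whose union with [S], rather than the
    sets themselves, is a preordering: this way the empty chain has an upper
    bound too. *)
Lemma preordering_maximal (S : F -> Prop) : preordering S ->
  exists M : F -> Prop, [/\ preordering M, forall x, S x -> M x &
    forall N : F -> Prop, preordering N -> (forall x, M x -> N x) ->
      forall x, N x -> M x].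
Proof.
move=> pS; pose P : set (set F) := fun A => preordering (fun x => A x \/ S x).
have [|A [PA maxA]] := @Zorn_bigcup F P.
  move=> C CP totC.
  have [SD SM S2 SN1] := pS.
  (* As the chain is total, any two elements lie in one of its members; the
     empty set stands for a member when both lie in [S]. *)
  have pick x y : ((\bigcup_(X in C) X)%classic x \/ S x) ->
      ((\bigcup_(X in C) X)%classic y \/ S y) ->
    exists X : set F, [/\ preordering (fun x => X x \/ S x),
      forall z, X z -> (\bigcup_(X in C) X)%classic z, X x \/ S x & X y \/ S y].
    have sub X : C X -> forall z, X z -> (\bigcup_(X in C) X)%classic z.
      by move=> CX z Xz; exists X.
    move=> [[X CX Xx]|Sx] [[Y CY Yy]|Sy].
    - have [XY|YX] := totC _ _ CX CY.
        exists Y; split; [exact: CP|exact: sub|left; exact: XY|by left].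
      exists X; split; [exact: CP|exact: sub|by left|left; exact: YX].
    - by exists X; split; [exact: CP|exact: sub|left|right].
    - by exists Y; split; [exact: CP|exact: sub|right|left].
    - exists (fun=> False); split; [|by []|by right|by right].
      by split=> [x' y'|x' y'|x'|] => [[//|?] [//|?]|[//|?] [//|?]||[]//];
        right; [exact: SD|exact: SM|exact: S2].
  split.
  - move=> x y Hx Hy; have [X [[XD _ _ _] sX Xx Xy]] := pick _ _ Hx Hy.
    by have [?|?] := XD _ _ Xx Xy; [left; exact: sX|right].
  - move=> x y Hx Hy; have [X [[_ XM _ _] sX Xx Xy]] := pick _ _ Hx Hy.
    by have [?|?] := XM _ _ Xx Xy; [left; exact: sX|right].
  - by move=> x; right.
  - by move=> H; have [X [[_ _ _]]] := pick _ _ H H.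
exists (fun x => A x \/ S x); split; [exact: PA|by right|].
move=> N pN AN x Nx; apply: contrapT => nx.
apply: (maxA (fun x => N x)).
  split; first by move=> z Az; apply: AN; left.
  by move=> /(_ _ Nx) Ax; apply: nx; left.
rewrite /P; suff -> : (fun x => N x \/ S x) = N by [].
apply/funext => z; apply/propext; split=> [[//|Sz]|]; last by left.
by apply: AN; right.
Qed.

(** A maximal preordering contains [x] or [- x] for every [x], since adjoining
    [x] is possible as soon as [- x] is missing. *)
Lemma preordering_extends (S : F -> Prop) : preordering S ->
  exists P : ordering F, forall x, S x -> x \in nonneg P.
Proof.
move=> /preordering_maximal [M [pM SM maxM]].
have [MD MM M2 MN1] := pM.
pose p : pred F := fun x => `[< M x >].
have pP x : (x \in p) <-> M x by split=> /asboolP.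
have tot x : (x \in p) || (- x \in p).
  apply/orP; have [?|nx] := pselect (M (- x)); first by right; apply/pP.
  left; apply/pP; apply: (maxM _ (preordering_adjoin pM nx)).
    move=> y My; exists y, (0 ^+ 2); split=> //; ring.
  exists (0 ^+ 2), (1 ^+ 2); split=> //; ring.
have anti x : x \in p -> - x \in p -> x = 0.
  move=> /pP Mx /pP MNx; apply/eqP/negPn/negP => x0; apply: MN1.
  suff -> : -1 = x * - x * x^-1 ^+ 2 by apply: (MM) => //; exact: MM.
  by field.
have pD x y : x \in p -> y \in p -> x + y \in p.
  by move=> /pP ? /pP ?; apply/pP/MD.
have pM' x y : x \in p -> y \in p -> x * y \in p.
  by move=> /pP ? /pP ?; apply/pP/MM.
by exists (Ordering pD pM' tot anti) => x Sx; apply/pP/SM.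
Qed.

Variable P : ordering F.

Lemma nonneg_sq x : x ^+ 2 \in nonneg P.
Proof.
rewrite expr2; have /orP[Px|Px] := nonneg_total P x; first exact: nonnegM.
by rewrite -mulrNN nonnegM.
Qed.

Lemma nonneg0 : 0 \in nonneg P.
Proof. by have := nonneg_sq 0; rewrite expr0n. Qed.

Lemma nonneg1 : 1 \in nonneg P.
Proof. by have := nonneg_sq 1; rewrite expr1n. Qed.

Lemma nonneg_nat n : n%:R \in nonneg P.
Proof.
by elim: n => [|n IH]; rewrite ?nonneg0 // -addn1 natrD nonnegD ?nonneg1.
Qed.

Lemma nonnegV x : x \in nonneg P -> x^-1 \in nonneg P.
Proof.
move=> Px; have [->|x0] := eqVneq x 0; first by rewrite invr0 nonneg0.
suff -> : x^-1 = x * x^-1 ^+ 2 by rewrite nonnegM ?nonneg_sq.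
by field.
Qed.

Lemma nonneg_sum (I : finType) (p : pred I) (f : I -> F) :
  (forall i, p i -> f i \in nonneg P) -> \sum_(i | p i) f i \in nonneg P.
Proof.
by move=> Pf; elim/big_ind: _ => //; [exact: nonneg0|exact: nonnegD].
Qed.

Lemma nonneg_sum_eq0 (I : finType) (f : I -> F) :
  (forall i, f i \in nonneg P) -> \sum_i f i = 0 -> forall i, f i = 0.
Proof.
move=> Pf f0 i; apply: (@nonneg_anti _ P) => //.
rewrite (bigD1 i) //= in f0; move/eqP: f0; rewrite addr_eq0 => /eqP ->.
by rewrite opprK nonneg_sum.
Qed.

Definition ord_sign (x : F) : int :=
  if x == 0 then 0 else if x \in nonneg P then 1 else -1.

Lemma ord_signE x : ord_sign x =
  ((x != 0) && (x \in nonneg P) : nat)%:Z -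
  ((x != 0) && (- x \in nonneg P) : nat)%:Z.
Proof.
rewrite /ord_sign; have [//|x0] := eqVneq x 0; have := nonneg_total P x.
case Px : (x \in nonneg P) => /=; last by move=> ->.
by case PNx : (- x \in nonneg P) => //; rewrite (nonneg_anti Px PNx) eqxx in x0.
Qed.

Lemma ord_sign_pos x : x != 0 -> x \in nonneg P -> ord_sign x = 1.
Proof. by rewrite /ord_sign => /negPf -> ->. Qed.

Lemma ord_sign1 : ord_sign 1 = 1.
Proof. by rewrite ord_sign_pos ?oner_eq0 ?nonneg1. Qed.

Lemma ord_signN x : ord_sign (- x) = - ord_sign x.
Proof. by rewrite !ord_signE oppr_eq0 opprK opprB. Qed.

Lemma ord_signM x y : ord_sign (x * y) = ord_sign x * ord_sign y.
Proof.
have pos u v : u \in nonneg P -> v \in nonneg P ->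
    ord_sign (u * v) = ord_sign u * ord_sign v.
  move=> Pu Pv; rewrite /ord_sign mulf_eq0.
  rewrite nonnegM // Pu Pv.
  by case: (u == 0); case: (v == 0).
have half u v : u \in nonneg P -> ord_sign (u * v) = ord_sign u * ord_sign v.
  move=> Pu; have /orP[Pv|Pv] := nonneg_total P v; first exact: pos.
  move: Pv; rewrite -{2 3}[v]opprK; move: (- v) => w Pw.
  by rewrite mulrN !ord_signN mulrN pos.
have /orP[Px|Px] := nonneg_total P x; first exact: half.
move: Px; rewrite -{2 3}[x]opprK; move: (- x) => w Pw.
by rewrite mulNr !ord_signN mulNr half.
Qed.

Lemma signature_count n (a : 'I_n -> F) :
  #|[pred i | (a i != 0) && (a i \in nonneg P)]|%:Z
  - #|[pred i | (a i != 0) && (- a i \in nonneg P)]|%:Z = \sum_i ord_sign (a i).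
Proof.
have cnt (p : pred 'I_n) : #|p|%:Z = \sum_i (p i : nat)%:Z.
  rewrite -[LHS]natz -sum1_card natr_sum big_mkcond /=.
  by apply: eq_bigr => i _; rewrite unfold_in; case: (p i).
by rewrite !cnt -sumrB; apply: eq_bigr => i _; rewrite ord_signE.
Qed.

End Orderings.

(** * Sylvester's law of inertia over an ordered field *)

Section Inertia.
Variables (F : fieldType) (P : ordering F).

Lemma wide_linear_ker p q (g : {linear 'rV[F]_p -> 'rV[F]_q}) :
  (q < p)%N -> exists2 v, v != 0 & g v = 0.
Proof.
move=> qp; have : kermx (lin1_mx g) != 0.
  by rewrite kermx_eq0 -row_leq_rank -ltnNge (leq_ltn_trans (rank_leq_col _)).
move=> /rowV0Pn [v vK v0]; exists v => //.
by move/sub_kermxP: vK; rewrite mul_rV_lin1.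
Qed.

Definition pos_index n (a : 'I_n -> F) : pred 'I_n :=
  [pred i | (a i != 0) && (a i \in nonneg P)].

(** A subspace on which the form is positive definite meets one on which it is
    negative semidefinite only in 0. *)
Lemma leq_pos_index n m (a : 'I_n -> F) (d : 'I_m -> F)
    (f : {linear 'rV[F]_n -> 'rV[F]_m}) : injective f ->
  (forall v, diag_form d (f v) = diag_form a v) ->
  (#|pos_index a| <= #|pos_index d|)%N.
Proof.
move=> f_inj fq; rewrite leqNgt; apply/negP => lt_da.
(* [ext] embeds the positive coordinates of [a]; [g] reads off the positive
   coordinates of [d] on the image of [f]. *)
pose ext (v : 'rV[F]_#|pos_index a|) : 'rV[F]_n :=
  \sum_k v 0 k *: delta_mx 0 (enum_val k).
have ext_lin : linear ext.
  move=> c u v; rewrite /ext scaler_sumr -big_split; apply: eq_bigr => k _.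
  by rewrite !mxE scalerDl scalerA.
pose g (v : 'rV[F]_#|pos_index a|) : 'rV[F]_#|pos_index d| :=
  \row_l (f (ext v)) 0 (enum_val l).
have g_lin : linear g.
  by move=> c u v; apply/rowP => l; rewrite !mxE ext_lin linearP !mxE.
pose gL := GRing.isLinear.Build F _ _ *:%R g g_lin.
pose g' : {linear 'rV[F]_#|pos_index a| -> 'rV[F]_#|pos_index d|} :=
  HB.pack g gL.
have [v v0 gv] := wide_linear_ker g' lt_da.
have extE k : ext v 0 (enum_val k) = v 0 k.
  rewrite /ext summxE (bigD1 k) //= !mxE !eqxx mulr1 big1 ?addr0 // => l lk.
  by rewrite !mxE eqxx /= (inj_eq enum_val_inj) eq_sym (negPf lk) mulr0.
have extN i : i \notin pos_index a -> ext v 0 i = 0.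
  move=> ia; rewrite /ext summxE big1 // => k _; rewrite !mxE eqxx /=.
  by case: eqP => [E|]; rewrite ?mulr0 //; rewrite E enum_valP in ia.
have posT i : a i * ext v 0 i ^+ 2 \in nonneg P.
  have [/andP[_ ai]|/extN ->] := boolP (i \in pos_index a).
    by rewrite nonnegM ?nonneg_sq.
  by rewrite expr2 !mulr0 nonneg0.
have negT i : - (d i * f (ext v) 0 i ^+ 2) \in nonneg P.
  have [id|] := boolP (i \in pos_index d).
    have /rowP/(_ (enum_rank_in id i)) := gv.
    by rewrite !mxE enum_rankK_in // => ->; rewrite expr2 !mulr0 oppr0 nonneg0.
  rewrite inE /= negb_and negbK => /orP[/eqP ->|di].
    by rewrite mul0r oppr0 nonneg0.
  rewrite -mulNr nonnegM ?nonneg_sq //.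
  by have := nonneg_total P (d i); rewrite (negPf di).
have q0 : \sum_i a i * ext v 0 i ^+ 2 = 0.
  apply: (@nonneg_anti _ P); first exact: nonneg_sum.
  by have := fq (ext v); rewrite /diag_form => <-; rewrite -sumrN nonneg_sum.
case/negP: v0; apply/eqP/rowP => k; rewrite mxE -extE.
have := nonneg_sum_eq0 posT q0 (enum_val k).
move=> /eqP; rewrite mulf_eq0 sqrf_eq0 => /orP[|/eqP //].
by have /andP[/negPf -> _] := enum_valP k.
Qed.

Lemma diag_formN n (a : 'I_n -> F) v :
  diag_form (fun i => - a i) v = - diag_form a v.
Proof. by rewrite -sumrN; apply: eq_bigr => i _; rewrite mulNr. Qed.

Lemma sum_ord_sign_isometric n m (a : 'I_n -> F) (d : 'I_m -> F)
    (f : {linear 'rV[F]_n -> 'rV[F]_m}) (g : {linear 'rV[F]_m -> 'rV[F]_n}) :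
  injective f -> injective g ->
  (forall v, diag_form d (f v) = diag_form a v) ->
  (forall v, diag_form a (g v) = diag_form d v) ->
  \sum_i ord_sign P (a i) = \sum_i ord_sign P (d i).
Proof.
move=> fi gi fq gq.
have E (a' : 'I_n -> F) (d' : 'I_m -> F) :
  (forall v, diag_form d' (f v) = diag_form a' v) ->
  (forall v, diag_form a' (g v) = diag_form d' v) ->
  #|pos_index a'| = #|pos_index d'|.
  move=> H H'; apply/eqP; rewrite eqn_leq.
  by rewrite !(leq_pos_index _ H, leq_pos_index _ H').
(* The negative entries of a form are the positive ones of its opposite. *)
have EN := E (fun i => - a i) (fun i => - d i).
rewrite -!signature_count -!/(pos_index _) (E a d) //; congr (_ - Posz _).
have cN k (c : 'I_k -> F) : #|[pred i | (c i != 0) && (- c i \in nonneg P)]| =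
    #|pos_index (fun i => - c i)|.
  by apply: eq_card => i; rewrite !inE oppr_eq0.
by rewrite !cN; apply: EN => v; rewrite !diag_formN ?fq ?gq.
Qed.

(** Two diagonalizations of [q] are isometric to each other, so any of them
    computes the signature. *)
Lemma signature_diag (V : vectType F) (q : V -> F) n (a : 'I_n -> F) :
  isometric q (diag_form a) -> signature P q = \sum_i ord_sign P (a i).
Proof.
move=> [f [[f' fK f'K] fq]].
apply: xget_unique.
  exists n, a; split; last by rewrite signature_count.
  by exists f; split=> //; exists f'.
move=> z [m [d [[g [[g' gK g'K] gq]] ->]]]; rewrite signature_count.
have inv_lin (W : vectType F) (h : {linear V -> W}) h' :
    cancel h h' -> cancel h' h -> linear h'.
  by move=> hK h'K c u v; apply: (can_inj hK); rewrite linearP !h'K.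
pose fL := GRing.isLinear.Build F _ _ *:%R f' (inv_lin _ _ _ fK f'K).
pose f1 : {linear 'rV[F]_n -> V} := HB.pack f' fL.
pose gL := GRing.isLinear.Build F _ _ *:%R g' (inv_lin _ _ _ gK g'K).
pose g1 : {linear 'rV[F]_m -> V} := HB.pack g' gL.
apply: (@sum_ord_sign_isometric _ _ d a (f \o g1) (g \o f1)).
- exact: inj_comp (can_inj fK) (can_inj g'K).
- exact: inj_comp (can_inj gK) (can_inj f'K).
- by move=> v /=; rewrite fq -gq g'K.
- by move=> v /=; rewrite gq -fq f'K.
Qed.

End Inertia.

(** * Similitudes of the hermitian forms <1, ..., 1> *)

Section HermitianMatrices.
Variables (F : fieldType) (A : falgType F) (sigma : involution A).

Lemma inv1 : sigma 1 = 1.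
Proof. by rewrite -[LHS]mul1r -{1}(invK sigma 1) -invM mul1r invK. Qed.

Lemma inv_scalar c : sigma c%:A = c%:A.
Proof. by rewrite linearZ /= inv1. Qed.

Definition adj m n (W : 'M[A]_(m, n)) : 'M[A]_(n, m) := (map_mx sigma W)^T.

Lemma adjM m n p (V : 'M[A]_(m, n)) (W : 'M[A]_(n, p)) :
  adj (V *m W) = adj W *m adj V.
Proof.
apply/matrixP => i j; rewrite !mxE linear_sum; apply: eq_bigr => k _.
by rewrite !mxE invM.
Qed.

Lemma adjN m n (W : 'M[A]_(m, n)) : adj (- W) = - adj W.
Proof. by apply/matrixP => i j; rewrite !mxE linearN. Qed.

Lemma adj0 m n : adj (0 : 'M[A]_(m, n)) = 0.
Proof. by apply/matrixP => i j; rewrite !mxE linear0. Qed.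

Lemma adjZ m n c (W : 'M[A]_(m, n)) : adj (c%:A *: W) = c%:A *: adj W.
Proof. by apply/matrixP => i j; rewrite !mxE !mulr_algl linearZ. Qed.

Lemma adjK m n (W : 'M[A]_(m, n)) : adj (adj W) = W.
Proof. by apply/matrixP => i j; rewrite !mxE invK. Qed.

Lemma adj_block m1 m2 n1 n2 (W1 : 'M[A]_(m1, n1)) (W2 : 'M[A]_(m1, n2))
    (W3 : 'M[A]_(m2, n1)) (W4 : 'M[A]_(m2, n2)) :
  adj (block_mx W1 W2 W3 W4) = block_mx (adj W1) (adj W3) (adj W2) (adj W4).
Proof. by rewrite /adj map_block_mx tr_block_mx. Qed.

Lemma algZA m n c d (W : 'M[A]_(m, n)) :
  c%:A *: (d%:A *: W) = (c * d)%:A *: W.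
Proof. by rewrite scalerA mulr_algl scalerA. Qed.

Lemma mulmx_algZr m n p c (V : 'M[A]_(m, n)) (W : 'M[A]_(n, p)) :
  V *m (c%:A *: W) = c%:A *: (V *m W).
Proof.
apply/matrixP => i j; rewrite !mxE mulr_algl scaler_sumr.
by apply: eq_bigr => k _; rewrite !mxE mulr_algl scalerAr.
Qed.

Lemma mulmx_algZl m n p c (V : 'M[A]_(m, n)) (W : 'M[A]_(n, p)) :
  (c%:A *: V) *m W = c%:A *: (V *m W).
Proof. by rewrite -scalemxAl. Qed.

(** Similitudes of the hermitian form [<1, ..., 1>] with multiplier [c]. The
    multiplier 0 is admitted, so that multipliers are closed under addition. *)
Definition similitude n (c : F) (W : 'M[A]_n) : Prop :=
  adj W *m W = c%:A *: 1%:M /\ W *m adj W = c%:A *: 1%:M.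

Lemma similitudeKl n m c (W : 'M[A]_n) (V : 'M[A]_(n, m)) :
  similitude c W -> adj W *m (W *m V) = c%:A *: V.
Proof. by case=> E _; rewrite mulmxA E mulmx_algZl mul1mx. Qed.

Lemma similitudeKr n m c (W : 'M[A]_n) (V : 'M[A]_(n, m)) :
  similitude c W -> W *m (adj W *m V) = c%:A *: V.
Proof. by case=> _ E; rewrite mulmxA E mulmx_algZl mul1mx. Qed.

Lemma similitudeM n c d (V W : 'M[A]_n) :
  similitude c V -> similitude d W -> similitude (c * d) (V *m W).
Proof.
move=> sV sW; split; rewrite adjM -!mulmxA.
  by rewrite (similitudeKl _ sV) mulmx_algZr (proj1 sW) algZA.
by rewrite (similitudeKr _ sW) mulmx_algZr (proj2 sV) algZA mulrC.
Qed.

Lemma adj1 n : adj (1%:M : 'M[A]_n) = 1%:M.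
Proof.
apply/matrixP => i j; rewrite !mxE eq_sym; case: eqP => _; last exact: linear0.
exact: inv1.
Qed.

Lemma similitude_scalar n c : similitude (c ^+ 2) (c%:A *: 1%:M : 'M[A]_n).
Proof.
by split; rewrite adjZ adj1 mulmx_algZl mul1mx algZA expr2.
Qed.

Lemma scalar_block n (c : F) :
  c%:A *: 1%:M = block_mx (c%:A *: 1%:M) 0 0 (c%:A *: 1%:M) :> 'M[A]_(n + n).
Proof. by rewrite !scalemx1 scalar_mx_block. Qed.

Lemma similitude_diag n c (W : 'M[A]_n) :
  similitude c W -> similitude c (block_mx W 0 0 W).
Proof.
move=> [E1 E2]; rewrite /similitude adj_block !adj0 !mulmx_block scalar_block.
by rewrite !mulmx0 !mul0mx !addr0 !add0r E1 E2.
Qed.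

(** The matrix form of the identity behind the multiplicativity of Pfister
    forms: the first column of the block matrix has length [c + d], and the
    second is chosen orthogonal to it and of the same length. *)
Lemma similitudeD n (c d : F) (V W : 'M[A]_n) : c != 0 -> d != 0 ->
  similitude c V -> similitude d W ->
  similitude (c + d) (block_mx V (c^-1%:A *: (V *m (V *m W)))
                               W (- (d^-1%:A *: (W *m (V *m W))))).
Proof.
move=> c0 d0 sV sW.
have DZ (p : F) q m1 m2 (X : 'M[A]_(m1, m2)) :
    p%:A *: X + q%:A *: X = (p + q)%:A *: X.
  by rewrite -scalerDl -scalerDl.
have Z1 m1 m2 (X : 'M[A]_(m1, m2)) : X = 1%:A *: X by rewrite !scale1r.
have zZ (p : F) q m1 m2 (X : 'M[A]_(m1, m2)) :
    p = q -> p%:A *: X - q%:A *: X = 0.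
  by move=> ->; rewrite subrr.
split; rewrite adj_block !mulmx_block scalar_block adjN !adjZ !adjM;
  rewrite !(mulmxN, mulNmx, opprK) !(mulmx_algZr, mulmx_algZl, algZA) -!mulmxA.
  congr block_mx.
  - by rewrite (proj1 sV) (proj1 sW) DZ.
  - rewrite !(similitudeKl _ sV, similitudeKl _ sW) !algZA; apply: zZ.
    by rewrite !mulVf.
  - rewrite (proj1 sV) (proj1 sW) !mulmx_algZr !algZA !mulmx1; apply: zZ.
    by rewrite !mulVf.
  - rewrite !(similitudeKl _ sV, similitudeKl _ sW, mulmx_algZr, algZA).
    rewrite (proj1 sW) !algZA DZ; congr (_%:A *: _).
    by field; rewrite c0 d0.
congr block_mx;
  rewrite !(similitudeKr _ sV, similitudeKr _ sW, mulmx_algZr, algZA).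
- rewrite (proj2 sV) algZA DZ; congr (_%:A *: _).
  by field; rewrite ?c0 ?d0.
- rewrite {1}[V *m _]Z1; apply: zZ.
  by field; rewrite ?c0 ?d0.
- rewrite {1}[W *m _]Z1; apply: zZ.
  by field; rewrite ?c0 ?d0.
- rewrite (proj2 sW) algZA DZ; congr (_%:A *: _).
  by field; rewrite ?c0 ?d0.
Qed.

(** Doubling by [n + n] makes block matrices over [pow2 k] matrices over
    [pow2 k.+1] by computation. *)
Definition pow2 k : nat := iter k (fun n => (n + n)%N) 1%N.

Definition multiplier (c : F) : Prop :=
  exists k (W : 'M[A]_(pow2 k)), similitude c W.

Lemma similitude_raise k l c (W : 'M[A]_(pow2 k)) : similitude c W ->
  (k <= l)%N -> exists V : 'M[A]_(pow2 l), similitude c V.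
Proof.
move=> sW /subnK <-; elim: (l - k)%N => [|j [V sV]]; first by exists W.
by exists (block_mx V 0 0 V); apply: similitude_diag.
Qed.

Lemma multiplier2 c d : multiplier c -> multiplier d ->
  exists k (V W : 'M[A]_(pow2 k)), similitude c V /\ similitude d W.
Proof.
move=> [k [V sV]] [l [W sW]]; exists (maxn k l).
have [V' sV'] := similitude_raise sV (leq_maxl k l).
have [W' sW'] := similitude_raise sW (leq_maxr k l).
by exists V', W'.
Qed.

(** Similitudes of different sizes are first brought to a common size by
    repetition along the diagonal. *)
Lemma multiplier_preordering : ~ multiplier (-1) -> preordering multiplier.
Proof.
move=> mN1; split=> // [c d mc md|c d mc md|c].
- have [->|c0] := eqVneq c 0; first by rewrite add0r.
  have [->|d0] := eqVneq d 0; first by rewrite addr0.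
  have [k [V [W [sV sW]]]] := multiplier2 mc md.
  by exists k.+1; eexists; exact: similitudeD c0 d0 sV sW.
- have [k [V [W [sV sW]]]] := multiplier2 mc md.
  by exists k, (V *m W); exact: similitudeM.
- by exists 0%N, (c%:A *: 1%:M); exact: similitude_scalar.
Qed.

Lemma multiplier_elt (g : A) c :
  sigma g * g = c%:A -> g * sigma g = c%:A -> multiplier c.
Proof.
move=> E1 E2; exists 0%N, g%:M.
have adjg : adj (g%:M : 'M[A]_(pow2 0)) = (sigma g)%:M.
  by apply/matrixP => i j; rewrite !mxE !ord1 eqxx.
by split; rewrite adjg scalemx1 -scalar_mxM ?E1 ?E2.
Qed.

Lemma multiplier_pos c : multiplier c ->
  exists n (W : 'M[A]_n.+1), similitude c W.
Proof.
move=> [k [W sW]]; have : (0 < pow2 k)%N.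
  by elim: k {W sW} => // k IH; rewrite /pow2 iterS addn_gt0 IH.
move: (pow2 k) W sW => [//|n] W sW _; by exists n, W.
Qed.

(** An element [u] with [u^* = - u] and [u^2 = 1] yields the idempotent
    [e = (1 + u) / 2], for which [e^* = 1 - e]. *)
Lemma hyperbolic_idempotent n (W : 'M[A]_n) : 2%:R != 0 :> F ->
  similitude (-1) W ->
  exists e : 'M[A]_(n + n), e *m e = e /\ adj e = 1%:M - e.
Proof.
move=> two0 [E1 E2]; pose u := block_mx 0 W (- adj W) 0.
have u2 : u *m u = 1%:M.
  rewrite mulmx_block !mulmx0 !mul0mx !addr0 !add0r mulmxN mulNmx E1 E2.
  by rewrite scaleN1r -scaleNr opprK !scale1r -scalar_mx_block.
have uN : adj u = - u.
  by rewrite adj_block !adj0 adjN adjK opp_block_mx !oppr0 opprK.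
have half m (X : 'M[A]_m) : (2^-1)%:A *: (X + X) = X.
  rewrite -[in X in X + X](scale1r X) -scalerDl scalerA mulr_algl -mulr2n.
  by rewrite -scaler_nat scalerA mulVf // !scale1r.
exists (2^-1%:A *: (1%:M + u)); split.
  rewrite mulmx_algZl mulmx_algZr mulmxDl mul1mx mulmxDr u2 mulmx1.
  by rewrite [u + _]addrC half.
rewrite adjZ; apply/eqP; rewrite eq_sym subr_eq -scalerDr -[X in X == _]half.
have -> : adj (1%:M + u) = 1%:M - u.
  rewrite -uN -[in RHS](adj1 (n + n)); apply/matrixP => i j.
  by rewrite !mxE linearD.
by rewrite addrACA addNr addr0.
Qed.
End HermitianMatrices.

(** * Matrices over an algebra with involution as a tensor product *)

Section MatrixTensor.
Variables (F : fieldType) (X : algInv F) (n : nat).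
Local Notation MX := (mat_inv F n (x) X)%ALG.

Definition tens_mx (x : MX) : 'M[X]_n.+1 :=
  \matrix_(i, j) tlift (fun (m : 'M[F]_n.+1) (a : X) => m i j *: a) x.

Lemma tens_mx_ptens (m : 'M[F]_n.+1) (a : X) :
  tens_mx (ptens m a) = \matrix_(i, j) (m i j *: a).
Proof.
apply/matrixP => i j; rewrite !mxE tlift_ptens // => [b|p] k u v.
  by rewrite !mxE scalerDl scalerA.
by rewrite scalerDr !scalerA mulrC.
Qed.

Lemma tens_mxD x y : tens_mx (x + y) = tens_mx x + tens_mx y.
Proof.
apply/matrixP => i j; rewrite !mxE; set f := (fun m a => _).
by have := tlift_linear f 1 x y; rewrite !scale1r.
Qed.

Lemma tens_mxN x : tens_mx (- x) = - tens_mx x.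
Proof.
have t0 : tens_mx 0 = 0.
  by apply: (addIr (tens_mx 0)); rewrite -tens_mxD !add0r.
by apply: (addIr (tens_mx x)); rewrite -tens_mxD !addNr.
Qed.

Lemma tens_mxM x y : tens_mx (x * y) = tens_mx x *m tens_mx y.
Proof.
elim/tens_ind: x => [m a|x x' IH IH']; last first.
  by rewrite mulrDl !tens_mxD mulmxDl IH IH'.
elim/tens_ind: y => [p b|y y' IH IH']; last first.
  by rewrite mulrDr !tens_mxD mulmxDr IH IH'.
rewrite tensM !tens_mx_ptens; apply/matrixP => i j; rewrite !mxE scaler_suml.
by apply: eq_bigr => k _; rewrite !mxE -scalerAl -scalerAr scalerA.
Qed.

Lemma tens_mx1 : tens_mx 1 = 1%:M.
Proof.
rewrite tens1 tens_mx_ptens; apply/matrixP => i j; rewrite !mxE.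
by case: (i == j); rewrite ?scale1r ?scale0r.
Qed.

Lemma tens_mx_inv x : tens_mx (inv MX x) = adj (inv X) (tens_mx x).
Proof.
elim/tens_ind: x => [m a|x y IH IH'].
  rewrite /= tens_invE !tens_mx_ptens; apply/matrixP => i j.
  by rewrite !mxE linearZ.
rewrite linearD !tens_mxD IH IH'; apply/matrixP => i j.
by rewrite !mxE linearD.
Qed.

Definition mx_tens (w : 'M[X]_n.+1) : MX :=
  \sum_i \sum_j (ptens (delta_mx i j : 'M[F]_n.+1) (w i j) : MX).

Lemma tens_mxK : cancel tens_mx mx_tens.
Proof.
elim/tens_ind => [m a|x y IH IH']; last first.
  rewrite -{2}IH -{2}IH' /mx_tens -big_split; apply: eq_bigr => i _ /=.
  rewrite -big_split; apply: eq_bigr => j _ /=.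
  by rewrite tens_mxD mxE /ptens linearD /= mulmxDr.
rewrite tens_mx_ptens /mx_tens {2}[m]matrix_sum_delta.
rewrite /ptens linear_sum linear_sum /= mulmx_suml; apply: eq_bigr => i _.
rewrite !linear_sum /= mulmx_suml; apply: eq_bigr => j _.
by rewrite mxE !linearZ /= -scalemxAl.
Qed.

Lemma mx_tensK : cancel mx_tens tens_mx.
Proof.
move=> w; have tens_mx0 : tens_mx 0 = 0.
  by rewrite -[0](addNr 0) tens_mxD tens_mxN addNr.
rewrite /mx_tens (big_morph tens_mx tens_mxD tens_mx0).
apply/matrixP => k l; rewrite summxE (bigD1 k) //= [X in _ + X]big1 ?addr0.
  rewrite (big_morph tens_mx tens_mxD tens_mx0) summxE (bigD1 l) //=.
    rewrite [X in _ + X]big1 ?addr0.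
    by rewrite tens_mx_ptens !mxE !eqxx scale1r.
  move=> j jl; rewrite tens_mx_ptens !mxE.
  by rewrite [l == j]eq_sym (negPf jl) andbF scale0r.
move=> i ik; rewrite (big_morph tens_mx tens_mxD tens_mx0) summxE big1 // => j _.
by rewrite tens_mx_ptens !mxE [k == i]eq_sym (negPf ik) scale0r.
Qed.

Lemma inv_hyperbolic_mx : inv_hyperbolic MX <->
  exists e : 'M[X]_n.+1, [/\ e != 0, e *m e = e & adj (inv X) e = 1%:M - e].
Proof.
have t_inj := can_inj tens_mxK.
split=> [[e [e0 ee eN]]|[e [e0 ee eN]]].
  exists (tens_mx e); split.
  - apply: contra_neq e0 => E; apply: t_inj.
    by rewrite E -[0 in RHS](addNr 0) tens_mxD tens_mxN addNr.
  - by rewrite -tens_mxM ee.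
  - by rewrite -tens_mx_inv eN tens_mxD tens_mxN tens_mx1.
exists (mx_tens e); split.
- apply: contra_neq e0 => E; rewrite -[e]mx_tensK E.
  by rewrite -[0 in LHS](addNr 0) tens_mxD tens_mxN addNr.
- by apply: t_inj; rewrite tens_mxM mx_tensK.
- by apply: t_inj; rewrite tens_mx_inv tens_mxD tens_mxN tens_mx1 mx_tensK.
Qed.

End MatrixTensor.

Section Isotropy.
Variables (F : fieldType) (X : algInv F).

(** Weak isotropy asks for nonzero entries only; the zero entries of an
    isotropic family can be dropped. *)
Lemma weakly_isotropic_family (I : finType) (x : I -> X) :
  (exists i, x i != 0) -> \sum_i inv X (x i) * x i = 0 ->
  inv_weakly_isotropic X.
Proof.
move=> [i0 xi0] sum0.
have main m (y : 'I_m -> X) : (0 < m)%N -> (forall i, y i != 0) ->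
    \sum_i inv X (y i) * y i = 0 -> inv_weakly_isotropic X.
  by case: m y => // m y _ y0 ys; exists m, y.
pose J := [pred i | x i != 0].
apply: (main #|J| (fun i => x (enum_val i))).
- by apply/card_gt0P; exists i0.
- by move=> i; have := enum_valP i.
rewrite -(big_enum_val (fun i => inv X (x i) * x i)) -[RHS]sum0.
rewrite [RHS](bigID (mem J)) /= [X in _ + X]big1 ?addr0 // => i.
by rewrite inE negbK => /eqP ->; rewrite mulr0.
Qed.

(** As [e^* e = (1 - e) e = 0], any nonzero column of [e] is an isotropic
    vector. *)
Lemma weakly_hyperbolic_isotropic :
  inv_weakly_hyperbolic X -> inv_weakly_isotropic X.
Proof.
move=> [n /inv_hyperbolic_mx [e [e0 ee eN]]].
have [i [j eij]] : exists i j, e i j != 0.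
  apply: contrapT => N; move/eqP: e0; apply; apply/matrixP => i j.
  by rewrite mxE; apply: contrapT => /eqP ?; apply: N; exists i, j.
apply: (weakly_isotropic_family (x := fun k => e k j)); first by exists i.
have : (adj (inv X) e *m e) j j = 0.
  by rewrite eN mulmxBl mul1mx ee subrr mxE.
by rewrite mxE => E; rewrite -[RHS]E; apply: eq_bigr => k _; rewrite !mxE.
Qed.

Lemma multiplier_weakly_hyperbolic : 2%:R != 0 :> F ->
  multiplier (inv X) (-1) -> inv_weakly_hyperbolic X.
Proof.
move=> two0 /multiplier_pos [n [W /(hyperbolic_idempotent two0) [e [ee eN]]]].
exists (n + n.+1)%N; apply/inv_hyperbolic_mx; exists e; split=> //.
apply/eqP => e0; move: eN; rewrite e0 subr0 => /matrixP/(_ 0 0)/eqP.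
by rewrite !mxE linear0 eqxx eq_sym (negPf (oner_neq0 _)).
Qed.

End Isotropy.

(** * Matrix representations over extension fields *)

(** The [K]-module [V] regarded as an [F]-module. The morphism [iota] is kept as
    a parameter of the type, from which the action of [F] is inferred. *)
Section RestrictionOfScalars.
Variables (F K : fieldType) (iota : {rmorphism F -> K}) (V : lmodType K).

Definition restr : Type := (fun _ : {rmorphism F -> K} => V) iota.
HB.instance Definition _ := GRing.Zmodule.on restr.

Definition restr_scale (c : F) (v : restr) : restr := iota c *: (v : V).

Fact restr_scaleA c d v : restr_scale c (restr_scale d v) = restr_scale (c * d) v.
Proof. by rewrite /restr_scale scalerA rmorphM. Qed.
Fact restr_scale1 : left_id 1 restr_scale.
Proof. by move=> v; rewrite /restr_scale rmorph1 scale1r. Qed.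
Fact restr_scaleDr : right_distributive restr_scale +%R.
Proof. by move=> c u v; rewrite /restr_scale scalerDr. Qed.
Fact restr_scaleDl v : {morph restr_scale^~ v : c d / c + d}.
Proof. by move=> c d; rewrite /restr_scale rmorphD scalerDl. Qed.

HB.instance Definition _ := GRing.Zmodule_isLmodule.Build F restr
  restr_scaleA restr_scale1 restr_scaleDr restr_scaleDl.

End RestrictionOfScalars.

Lemma tensmx11 (R : comPzRingType) m n :
  (1%:M : 'M[R]_m) *t (1%:M : 'M[R]_n) = 1%:M.
Proof.
apply/matrixP => i j.
case: (mxtens_indexP i) => i0 i1; case: (mxtens_indexP j) => j0 j1.
rewrite tensmxE !mxE (can_eq (@mxtens_indexK m n)) xpair_eqE.
by case: (i0 == j0); rewrite ?mul0r ?mul1r.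
Qed.

Section Representations.
Variables (F K L : fieldType) (iota : {rmorphism F -> K}).

Local Notation "{ 'rep' A , n }" := {lrmorphism A -> 'M[K]_n.+1 | iota \; *:%R}
  (at level 0, A at level 99).

Section Tensor.
Variables (A B : falgType F) (p q : nat).
Variables (phi : {rep A, p}) (psi : {rep B, q}).

Definition tens_rep_size := (p.+1 * q.+1).-1.

Local Notation W := (restr iota 'M[K]_tens_rep_size.+1).

Definition tens_rep_pure (a : A) (b : B) : W := (phi a *t psi b : 'M_(_ * _)).

Fact tens_rep_linl b : linear (tens_rep_pure^~ b).
Proof.
move=> k u v; apply/matrixP => i j.
by rewrite /tens_rep_pure linearP /= !mxE mulrDl mulrA.
Qed.

Fact tens_rep_linr a : linear (tens_rep_pure a).
Proof.
move=> k u v; apply/matrixP => i j.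
by rewrite /tens_rep_pure linearP /= !mxE mulrDr mulrCA.
Qed.

Definition tens_rep (x : tens A B) : 'M[K]_tens_rep_size.+1 :=
  tlift tens_rep_pure x.

Lemma tens_repE a b : tens_rep (ptens a b) = (phi a *t psi b : 'M_(_ * _)).
Proof. exact: (tlift_ptens tens_rep_linl tens_rep_linr). Qed.

Fact tens_rep_linear : linear_for (iota \; *:%R) tens_rep.
Proof. exact: (tlift_linear tens_rep_pure). Qed.

Fact tens_repD x y : tens_rep (x + y) = tens_rep x + tens_rep y.
Proof.
have := tens_rep_linear 1 x y; rewrite !scale1r => ->.
by rewrite /= rmorph1 scale1r.
Qed.

Fact tens_rep_monoid : monoid_morphism tens_rep.
Proof.
split; first by rewrite tens1 tens_repE !rmorph1 tensmx11.
elim/tens_ind => [a b|x x' IH IH'] y; last first.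
  by rewrite mulrDl !tens_repD IH IH' mulrDl.
elim/tens_ind: y => [a' b'|y y' IH IH']; last first.
  by rewrite mulrDr !tens_repD IH IH' mulrDr.
rewrite tensM !tens_repE !rmorphM.
exact: esym (tensmx_mul (phi a) (psi b) (phi a') (psi b')).
Qed.

HB.instance Definition _ := GRing.isLinear.Build F (tens A B)
  'M[K]_tens_rep_size.+1 (iota \; *:%R) tens_rep tens_rep_linear.
HB.instance Definition _ := GRing.isMonoidMorphism.Build (tens A B)
  'M[K]_tens_rep_size.+1 tens_rep tens_rep_monoid.

Definition tens_representation : {rep tens A B, tens_rep_size} := tens_rep.

End Tensor.

Section Extension.
Variables (A : falgType F) (n : nat) (j : {rmorphism K -> L}) (phi : {rep A, n}).

Definition ext_rep : A -> 'M[L]_n.+1 := map_mx j \o phi.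
Definition ext_iota : {rmorphism F -> L} := j \o iota.

Fact ext_rep_linear : linear_for (ext_iota \; *:%R) ext_rep.
Proof. by move=> c u v; rewrite /ext_rep /= linearP /= map_mxD map_mxZ. Qed.

Fact ext_rep_monoid : monoid_morphism ext_rep.
Proof.
by split=> [|x y]; rewrite /ext_rep /= ?rmorph1 ?map_mx1 // rmorphM map_mxM.
Qed.

HB.instance Definition _ := GRing.isLinear.Build F A 'M[L]_n.+1
  (ext_iota \; *:%R) ext_rep ext_rep_linear.
HB.instance Definition _ := GRing.isMonoidMorphism.Build A 'M[L]_n.+1
  ext_rep ext_rep_monoid.

Definition ext_representation :
  {lrmorphism A -> 'M[L]_n.+1 | ext_iota \; *:%R} := ext_rep.

End Extension.
End Representations.

(** Either [a] is a square in [K], or ['X^2 - a] is irreducible and has a root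
    in a quadratic extension. *)
Lemma sqrt_extension (K : fieldType) (a : K) :
  exists (L : fieldType) (j : {rmorphism K -> L}) (s : L), s ^+ 2 = j a.
Proof.
have [[s sa]|nosq] := pselect (exists s : K, s ^+ 2 = a).
  by exists K, idfun, s.
pose p : {poly K} := 'X^2 - a%:P.
have sp : size p = 3 by rewrite size_XnsubC.
have irr : irreducible_poly p.
  apply: cubic_irreducible; first by rewrite sp.
  move=> x; apply/negP; rewrite /root !hornerE subr_eq0 => /eqP xa.
  by apply: nosq; exists x.
have [L _ [z /rootP pz _]] := irredp_FAdjoin irr.
exists L, (in_alg L), z; move: pz.
rewrite /p rmorphB /= map_polyXn map_polyC /= !hornerE => /eqP.
by rewrite subr_eq0 => /eqP.
Qed.

(** * Quaternion algebras *)

Section QuaternionRelations.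
Variables (F : fieldType) (Q : falgType F) (i j : Q).

Definition quat_of (x0 x1 x2 x3 : F) : Q :=
  x0%:A + x1 *: i + x2 *: j + x3 *: (i * j).

Variables (a b : F).
Hypotheses (ii : i * i = a%:A) (jj : j * j = b%:A) (ji : j * i = - (i * j)).

Lemma quatD x0 x1 x2 x3 y0 y1 y2 y3 : quat_of x0 x1 x2 x3 + quat_of y0 y1 y2 y3 =
  quat_of (x0 + y0) (x1 + y1) (x2 + y2) (x3 + y3).
Proof.
rewrite /quat_of !scalerDl [LHS]addrACA; congr (_ + _).
by rewrite [LHS]addrACA; congr (_ + _); rewrite [LHS]addrACA.
Qed.

Lemma quatZ c x0 x1 x2 x3 :
  c *: quat_of x0 x1 x2 x3 = quat_of (c * x0) (c * x1) (c * x2) (c * x3).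
Proof. by rewrite /quat_of !scalerDr !scalerA. Qed.

Lemma quat_muli x0 x1 x2 x3 :
  i * quat_of x0 x1 x2 x3 = quat_of (a * x1) x0 (a * x3) x2.
Proof.
rewrite /quat_of !mulrDr -!scalerAr mulr1 mulrA ii mulr_algl !scalerA.
rewrite [x1 * a]mulrC [x3 * a]mulrC [x0 *: i + _]addrC -!addrA.
by congr (_ + (_ + _)); rewrite addrC.
Qed.

Lemma quat_mulj x0 x1 x2 x3 :
  j * quat_of x0 x1 x2 x3 = quat_of (b * x2) (- (b * x3)) x0 (- x1).
Proof.
have jk : j * (i * j) = - (b *: i).
  by rewrite mulrA ji mulNr -mulrA jj mulr_algr.
rewrite /quat_of !mulrDr -!scalerAr mulr1 ji jj jk !scalerN !scaleNr !scalerA.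
rewrite [x2 * b]mulrC [x3 * b]mulrC.
by rewrite -[LHS]addrA [LHS]addrC !addrA.
Qed.

Lemma quatM x0 x1 x2 x3 y0 y1 y2 y3 : quat_of x0 x1 x2 x3 * quat_of y0 y1 y2 y3 =
  quat_of (x0 * y0 + a * x1 * y1 + b * x2 * y2 - a * b * x3 * y3)
       (x0 * y1 + x1 * y0 - b * x2 * y3 + b * x3 * y2)
       (x0 * y2 + x2 * y0 + a * x1 * y3 - a * x3 * y1)
       (x0 * y3 + x3 * y0 + x1 * y2 - x2 * y1).
Proof.
rewrite {1}/quat_of !mulrDl -!scalerAl mul1r -[i * j * _]mulrA.
rewrite !(quat_muli, quat_mulj).
by rewrite !(quatZ, quatD); congr (quat_of _ _ _ _); ring.
Qed.

End QuaternionRelations.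

Section QuaternionBasis.
Variables (F : fieldType) (Q : falgType F).

Definition quat_basis (a b : F) (i j : Q) : Prop :=
  [/\ a != 0, b != 0, [/\ i * i = a%:A, j * j = b%:A & j * i = - (i * j)]
    & basis_of fullv [:: 1; i; j; i * j]].

Variables (a b : F) (i j : Q).
Hypothesis ijP : quat_basis a b i j.
Local Notation quat := (quat_of i j).

Definition quat_coord (k : 'I_4) (x : Q) : F :=
  coord [tuple 1; i; j; i * j] k x.

Local Notation c0 := (quat_coord (inord 0)).
Local Notation c1 := (quat_coord (inord 1)).
Local Notation c2 := (quat_coord (inord 2)).
Local Notation c3 := (quat_coord (inord 3)).

Let ii : i * i = a%:A. Proof. by case: ijP => _ _ []. Qed.
Let jj : j * j = b%:A. Proof. by case: ijP => _ _ []. Qed.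
Let ji : j * i = - (i * j). Proof. by case: ijP => _ _ []. Qed.
Let qM := quatM ii jj ji.
Let basisP : basis_of fullv [tuple 1; i; j; i * j]. Proof. by case: ijP. Qed.

Lemma quatE x : x = quat (c0 x) (c1 x) (c2 x) (c3 x).
Proof.
rewrite {1}(coord_basis basisP (memvf x)) !big_ord_recl big_ord0 addr0 !addrA.
by rewrite /quat_of /quat_coord; congr (_ + _ + _ + _);
   congr (coord _ _ _ *: _); apply: val_inj; rewrite /= inordK.
Qed.

Lemma quatK x0 x1 x2 x3 : let x := quat x0 x1 x2 x3 in
  [/\ c0 x = x0, c1 x = x1, c2 x = x2 & c3 x = x3].
Proof.
pose c := [tuple x0; x1; x2; x3].
have E k : quat_coord k (quat x0 x1 x2 x3) = tnth c k.
  have -> : quat x0 x1 x2 x3 = \sum_(l < 4) tnth c l *: [:: 1; i; j; i * j]`_l.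
    by rewrite !big_ord_recl big_ord0 addr0 !addrA.
  rewrite /quat_coord (coord_sum_free (X := [tuple 1; i; j; i * j])) //.
  exact: basis_free basisP.
by move=> x; rewrite /x !E !(tnth_nth 0) /= !inordK.
Qed.

Lemma quat_coordD k x y : quat_coord k (x + y) = quat_coord k x + quat_coord k y.
Proof. by rewrite /quat_coord linearD. Qed.

Lemma quat_coordZ k c x : quat_coord k (c *: x) = c * quat_coord k x.
Proof. by rewrite /quat_coord linearZ. Qed.

Lemma quat_coordN k x : quat_coord k (- x) = - quat_coord k x.
Proof. by rewrite /quat_coord linearN. Qed.

(** Half of the reduced trace: the constant coordinate in the standard basis. *)
Definition quat_tr (x : Q) : F := c0 x.

Lemma quat_tr_quat x0 x1 x2 x3 : quat_tr (quat x0 x1 x2 x3) = x0.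
Proof. by have [] := quatK x0 x1 x2 x3. Qed.

Lemma quat_tr_scalar c : quat_tr c%:A = c.
Proof.
have -> : c%:A = quat c 0 0 0 by rewrite /quat_of !scale0r !addr0.
exact: quat_tr_quat.
Qed.

Lemma quat_trC x y : quat_tr (x * y) = quat_tr (y * x).
Proof. by rewrite (quatE x) (quatE y) !qM !quat_tr_quat; ring. Qed.

Hypothesis two0 : 2%:R != 0 :> F.

Lemma quat_oppr_eq0 (V : lmodType F) (v : V) : v = - v -> v = 0.
Proof.
move/eqP; rewrite -addr_eq0 -mulr2n -scaler_nat scaler_eq0 (negPf two0).
by move/eqP.
Qed.

(** Conjugating by [j] (resp. by [i]) changes the sign of [i] and [i * j]
    (resp. of [j]), so that all three have trace 0. *)
Lemma quat_trace_unique (V : zmodType) (f : {additive Q -> V}) :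
  (forall x y, f (x * y) = f (y * x)) -> forall x, f x = f (quat_tr x)%:A.
Proof.
move=> fC x; have [a0 b0 _ _] := ijP.
have anti y z c : c != 0 -> z * z = c%:A -> y * z = - (z * y) ->
    forall d, f (d *: y) = 0.
  move=> cn0 zz yz d.
  have fN e : f (e *: y) = - f (e *: y).
    rewrite -raddfN; have {1}-> : e *: y = (e / c) *: (y * z) * z.
      by rewrite -scalerAl -mulrA zz mulr_algr scalerA mulfVK.
    rewrite fC -scalerAr mulrA -[z * y]opprK -yz mulNr -mulrA zz mulr_algr.
    by rewrite scalerN scalerA mulfVK.
  have -> : d *: y = (d / 2%:R) *: y + (d / 2%:R) *: y.
    by rewrite -scalerDl -mulrDl -mulr2n -[d *+ 2]mulr_natr mulfK.
  by rewrite raddfD {1}fN addNr.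
rewrite {1}(quatE x) /quat_of !raddfD /=.
rewrite (anti i j b) // ?(anti j i a) // ?(anti (i * j) i a) ?addr0 //.
- by rewrite -mulrA ji mulrN.
- by rewrite ji opprK.
Qed.

(** The polarization of [x^2 = - Nrd(x)] on pure quaternions. *)
Lemma quat_pure_anticomm x y : quat_tr x = 0 -> quat_tr y = 0 ->
  x * y + y * x = (quat_tr (x * y) *+ 2)%:A.
Proof.
rewrite /quat_tr => x0 y0; rewrite (quatE x) (quatE y) x0 y0 !qM.
rewrite -/(quat_tr _) quat_tr_quat quatD mulr2n.
have -> : forall c : F, c%:A = quat c 0 0 0.
  by move=> c; rewrite /quat_of !scale0r !addr0.
by congr (quat _ _ _ _); ring.
Qed.

(** In a vanishing combination of [1, u, v, uv] the constant coefficient is the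
    trace; multiplying by [u] and [v] brings the other coefficients to the
    constant place. *)
Lemma quat_basis_anticomm u v (a' b' : F) : a' != 0 -> b' != 0 ->
  quat_tr u = 0 -> quat_tr v = 0 ->
  u * u = a'%:A -> v * v = b'%:A -> v * u = - (u * v) ->
  quat_basis a' b' u v.
Proof.
move=> a0 b0 u0 v0 uu vv vu.
have trN x : quat_tr (- x) = - quat_tr x by exact: quat_coordN.
have trD x y : quat_tr (x + y) = quat_tr x + quat_tr y by exact: quat_coordD.
have trZ c x : quat_tr (c *: x) = c * quat_tr x by exact: quat_coordZ.
have w0 : quat_tr (u * v) = 0.
  by apply: (@quat_oppr_eq0 F^o); rewrite {1}quat_trC vu trN.
have tr_uv k0 k1 k2 k3 : quat_tr (@quat_of F Q u v k0 k1 k2 k3) = k0.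
  by rewrite !trD quat_tr_scalar !trZ u0 v0 w0 !mulr0 !addr0.
have E0 k0 k1 k2 k3 : @quat_of F Q u v k0 k1 k2 k3 = 0 -> k0 = 0.
  by move=> /(congr1 quat_tr); rewrite tr_uv -(scale0r 1) quat_tr_scalar.
split=> //; have dimQ : \dim {:Q} = 4 by exact: size_basis basisP.
rewrite basisEfree subvf dimQ leqnn !andbT.
rewrite -[X in free X]/(tval [tuple 1; u; v; u * v]).
apply/freeP => k.
rewrite !big_ord_recl big_ord0 addr0 !addrA /=.
set k0 := k _; set k1 := k _; set k2 := k _; set k3 := k _.
rewrite -/(@quat_of F Q u v k0 k1 k2 k3) => E.
have K0 := E0 _ _ _ _ E.
have K1 : k1 = 0.
  have := @quat_muli F Q u v a' uu k0 k1 k2 k3; rewrite E mulr0 => /esym/E0/eqP.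
  by rewrite mulf_eq0 (negPf a0) => /eqP.
have K2 : k2 = 0.
  have := quat_mulj vv vu k0 k1 k2 k3; rewrite E mulr0 => /esym/E0/eqP.
  by rewrite mulf_eq0 (negPf b0) => /eqP.
have K3 : k3 = 0.
  have := @quat_muli F Q u v a' uu (b' * k2) (- (b' * k3)) k0 (- k1).
  rewrite -(quat_mulj vv vu) E !mulr0 => /esym/E0/eqP.
  by rewrite !(mulf_eq0, oppr_eq0) (negPf a0) (negPf b0) => /eqP.
case=> [[|[|[|[|//]]]] lt4].
- by rewrite -[RHS]K0; congr (k _); apply: val_inj.
- by rewrite -[RHS]K1; congr (k _); apply: val_inj.
- by rewrite -[RHS]K2; congr (k _); apply: val_inj.
- by rewrite -[RHS]K3; congr (k _); apply: val_inj.
Qed.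
End QuaternionBasis.

Section AdaptedBasis.
Variables (F : fieldType) (Q : falgType F) (sigma : involution Q).
Hypotheses (two0 : 2%:R != 0 :> F) (Q_quat : quaternion Q) (Q_div : division_alg Q).

(** The involution preserves the trace, hence the 3-dimensional space of pure
    quaternions, which is the sum of its eigenspaces for 1 and -1. Elements of
    different eigenspaces have a product of trace 0, and so anticommute; if one
    eigenspace is zero, any standard basis will do. *)
Lemma adapted_quat_basis : exists (a b s t : F) (u v : Q),
  [/\ quat_basis a b u v, s != 0, t != 0, sigma u = s *: u & sigma v = t *: v].
Proof.
have [a [b [i [j ijP]]]] := Q_quat; pose tr := quat_tr i j.
have [a0 b0 [ii jj ji] _] := ijP.
have trC : forall x y, tr (x * y) = tr (y * x) := quat_trC ijP.
have trD x y : tr (x + y) = tr x + tr y by exact: quat_coordD.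
have trN x : tr (- x) = - tr x by exact: quat_coordN.
have tr_sc c : tr c%:A = c by exact: quat_tr_scalar ijP c.
have tr_q x0 x1 x2 x3 : tr (quat_of i j x0 x1 x2 x3) = x0.
  by exact: quat_tr_quat ijP _ _ _ _.
have tr_sigma x : tr (sigma x) = tr x.
  pose f y : F^o := tr (sigma y).
  have fL : linear f.
    by move=> c y z; rewrite /f linearP trD /tr /quat_tr quat_coordZ.
  pose fP := GRing.isLinear.Build F Q F^o *:%R f fL.
  pose f' : {linear Q -> F^o} := HB.pack f fP.
  have fC y z : f' (y * z) = f' (z * y) by rewrite /= /f !invM trC.
  have := quat_trace_unique ijP two0 fC x.
  by rewrite /= /f inv_scalar tr_sc.
have sq u : tr u = 0 -> u * u = (tr (u * u))%:A.
  move=> u0; have E := quat_pure_anticomm ijP u0 u0.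
  by apply: (scalerI two0); rewrite scalerA mulr_natl -E scaler_nat.
have sq0 u : u != 0 -> tr u = 0 -> tr (u * u) != 0.
  move=> un0 u0; have uU := Q_div un0.
  have : u * u \is a GRing.unit by rewrite unitrMl.
  by apply: contraTneq => E; rewrite (sq _ u0) E scale0r unitr0.
have [[u [un0 u0 su]]|noP] :=
    pselect (exists u, [/\ u != 0, tr u = 0 & sigma u = u]); last first.
  have sN x : tr x = 0 -> sigma x = - x.
    move=> x0; apply/eqP; rewrite -addr_eq0; apply/negP => /negP n0.
    apply: noP; exists (sigma x + x); split=> //.
      by rewrite trD tr_sigma x0 addr0.
    by rewrite linearD invK addrC.
  exists a, b, (-1), (-1), i, j; rewrite oppr_eq0 oner_eq0 !scaleN1r; split=> //.
    by apply: sN; rewrite -(tr_q 0 1 0 0) /quat_of scale1r !scale0r add0r !addr0.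
  by apply: sN; rewrite -(tr_q 0 0 1 0) /quat_of scale1r !scale0r !add0r !addr0.
have [[v [vn0 v0 sv]]|noN] :=
    pselect (exists v, [/\ v != 0, tr v = 0 & sigma v = - v]); last first.
  have sP x : tr x = 0 -> sigma x = x.
    move=> x0; apply/eqP; rewrite -subr_eq0; apply/negP => /negP n0.
    apply: noN; exists (sigma x - x); split=> //.
      by rewrite trD trN tr_sigma x0 subrr.
    by rewrite linearB invK opprB.
  exists a, b, 1, 1, i, j; rewrite oner_eq0 !scale1r; split=> //.
    by apply: sP; rewrite -(tr_q 0 1 0 0) /quat_of scale1r !scale0r add0r !addr0.
  by apply: sP; rewrite -(tr_q 0 0 1 0) /quat_of scale1r !scale0r !add0r !addr0.
have uv0 : tr (u * v) = 0.
  apply: (@quat_oppr_eq0 _ two0 F^o).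
  by rewrite {1}trC -tr_sigma invM su sv mulrN trN.
have vu : v * u = - (u * v).
  apply/eqP; rewrite -addr_eq0 addrC; apply/eqP.
  by rewrite (quat_pure_anticomm ijP u0 v0) -/tr -/(tr _) uv0 mul0rn scale0r.
exists (tr (u * u)), (tr (v * v)), 1, (-1), u, v.
rewrite oppr_eq0 oner_eq0 scale1r scaleN1r; split=> //.
exact: (quat_basis_anticomm ijP two0 (sq0 _ un0 u0) (sq0 _ vn0 v0) u0 v0
  (sq _ u0) (sq _ v0) vu).
Qed.

End AdaptedBasis.

Section QuaternionRepresentation.
Variables (F L : fieldType) (Q : falgType F) (iota : {rmorphism F -> L}).
Variables (a b : F) (i j : Q) (ijP : quat_basis a b i j).
Variables (s : L) (sa : s ^+ 2 = iota a).

(** The splitting of the quaternion algebra [(a, b)] by a square root [s] of [a]: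
    [i] goes to [diag(s, -s)] and [j] to [[0, 1; b, 0]]. *)
Definition quat_rep_entry (x0 x1 x2 x3 : F) (k l : bool) : L :=
  if k then
    if l then iota x0 - iota x1 * s else iota b * (iota x2 - iota x3 * s)
  else if l then iota x2 + iota x3 * s else iota x0 + iota x1 * s.

Definition quat_rep (x : Q) : 'M[L]_2 := \matrix_(k, l)
  quat_rep_entry (quat_coord i j (inord 0) x) (quat_coord i j (inord 1) x)
    (quat_coord i j (inord 2) x) (quat_coord i j (inord 3) x) (k != 0) (l != 0).

Fact quat_rep_linear : linear_for (iota \; *:%R) quat_rep.
Proof.
move=> k u v; apply/matrixP => m n; rewrite !mxE !quat_coordD !quat_coordZ.
by rewrite /quat_rep_entry; case: (m != 0); case: (n != 0);
   rewrite !(rmorphD, rmorphM) /=; ring.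
Qed.

Lemma quat_repE x0 x1 x2 x3 : quat_rep (quat_of i j x0 x1 x2 x3) =
  \matrix_(k, l) quat_rep_entry x0 x1 x2 x3 (k != 0) (l != 0).
Proof. by rewrite /quat_rep; have [-> -> -> ->] := quatK ijP x0 x1 x2 x3. Qed.

Fact quat_rep_monoid : monoid_morphism quat_rep.
Proof.
have [a0 b0 [ii jj ji] _] := ijP.
split=> [|x y].
  have -> : 1 = quat_of i j 1 0 0 0 :> Q.
    by rewrite /quat_of scale1r !scale0r !addr0.
  rewrite quat_repE; apply/matrixP => m n; rewrite !mxE /quat_rep_entry.
  rewrite !rmorph0 rmorph1.
  by case: m => [[|[|//]] ?]; case: n => [[|[|//]] ?] /=; ring.
rewrite (quatE ijP x) (quatE ijP y) (quatM ii jj ji) !quat_repE.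
apply/matrixP => m n; rewrite !mxE !big_ord_recl big_ord0 !mxE addr0 /=.
rewrite /quat_rep_entry; case: (m != 0); case: (n != 0);
  rewrite !(rmorphD, rmorphM, rmorphN) /= -sa; ring.
Qed.

HB.instance Definition _ := GRing.isLinear.Build F Q 'M[L]_2
  (iota \; *:%R) quat_rep quat_rep_linear.
HB.instance Definition _ := GRing.isMonoidMorphism.Build Q 'M[L]_2
  quat_rep quat_rep_monoid.

Definition quat_representation : {lrmorphism Q -> 'M[L]_2 | iota \; *:%R} :=
  quat_rep.

End QuaternionRepresentation.

(** * Algebras with involution carrying a Pfister form *)

(** The structure of a decomposable algebra that the theorem depends on, in a
    form inherited by tensor products. The basis [pf_vec] is orthogonal for
    [(x, y) |-> pf_tr (sigma(x) y)], with diagonal [pf_coef / (pf_deg + 1)]: the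
    coefficients [pf_coef] are the entries of the Pfister form, repeated once for
    each matrix unit, and the denominator is the degree of the matrix factor.
    The functional [pf_tr] is the reduced trace divided by the degree of the
    algebra; it is characterized, by [pf_tr_unique], as the projection to [F]
    along commutators. The field [pf_ord_sign] is the alternative satisfied by the
    signature of a Pfister form. In [pf_split] the field to be extended is
    arbitrary, so that the factors of a tensor product can be split one after
    the other over the same field. *)
Record pfister (F : fieldType) (X : algInv F) := Pfister {
  pf_index : finType;
  pf_vec : pf_index -> X;
  pf_coef : pf_index -> F;
  pf_deg : nat;
  pf_tr : X -> F;
  pf_trL : linear (pf_tr : X -> F^o);
  pf_tr_unique : forall (V : zmodType) (f : {additive X -> V}),
    (forall x y, f (x * y) = f (y * x)) -> forall x, f x = f (pf_tr x)%:A;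
  pf_span : forall x, exists c : pf_index -> F, x = \sum_k c k *: pf_vec k;
  pf_orth : forall k l, pf_tr (inv X (pf_vec k) * pf_vec l) =
    if k == l then pf_coef k / pf_deg.+1%:R else 0;
  pf_coef_neq0 : forall k, pf_coef k != 0;
  pf_coef_mult : forall k, exists g : X,
    inv X g * g = (pf_coef k)%:A /\ g * inv X g = (pf_coef k)%:A;
  pf_ord_sign : forall P : ordering F,
    (forall k, pf_coef k \in nonneg P) \/ \sum_k ord_sign P (pf_coef k) = 0;
  pf_split : forall (K : fieldType) (iota : {rmorphism F -> K}),
    exists (L : fieldType) (j : {rmorphism K -> L}) (n : nat)
      (phi : {lrmorphism X -> 'M[L]_n.+1 | ext_iota iota j \; *:%R}),
      (n.+1 ^ 2)%N = dim X }.

Section MatrixAlgebra.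
Variables (F : fieldType) (s : nat).
Hypothesis char0 : forall n, n.+1%:R != 0 :> F.
Local Notation M := (mat_inv F s).

Definition mat_tr (x : 'M[F]_s.+1) : F := \tr x / s.+1%:R.

Fact mat_trL : linear (mat_tr : 'M[F]_s.+1 -> F^o).
Proof. by move=> c x y; rewrite /mat_tr linearP mulrDl -mulrA. Qed.

(** Off-diagonal matrix units are commutators, and the diagonal ones are equal
    modulo commutators. *)
Fact mat_tr_unique (V : zmodType) (f : {additive M -> V}) :
  (forall x y, f (x * y) = f (y * x)) -> forall x, f x = f (mat_tr x)%:A.
Proof.
move=> fC x.
have fE (c : F) (k l : 'I_s.+1) : f (c *: delta_mx k l) =
    if k == l then f (c *: delta_mx 0 0 : 'M[F]_s.+1) else 0.
  have cut (p q r : 'I_s.+1) :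
      (delta_mx p q : 'M[F]_s.+1) * delta_mx q r = delta_mx p r.
    by rewrite -[LHS]/(delta_mx _ _ *m delta_mx _ _) mul_delta_mx.
  rewrite -(cut k k l) scalerAl fC -scalerAr.
  case: eqP => [->|kl]; last first.
    rewrite -[_ * _]/(delta_mx _ _ *m delta_mx _ _).
    rewrite mul_delta_mx_0 ?scaler0 ?raddf0 //.
    by apply/eqP => E; apply: kl.
  rewrite cut -(cut l 0 l) scalerAl fC.
  by rewrite -scalerAr cut.
have fT (y : 'M[F]_s.+1) : f y = f ((\tr y) *: delta_mx 0 0 : 'M[F]_s.+1).
  rewrite {1}[y]matrix_sum_delta raddf_sum /mxtrace scaler_suml raddf_sum.
  apply: eq_bigr => k _; rewrite raddf_sum (bigD1 k) //= big1 ?addr0.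
    by rewrite fE eqxx.
  by move=> l lk; rewrite fE eq_sym (negPf lk).
rewrite fT [RHS]fT linearZ /= mxtrace1; congr (f (_ *: _)).
by rewrite /mat_tr mulfVK.
Qed.

Fact mat_span (x : 'M[F]_s.+1) : exists c : 'I_s.+1 * 'I_s.+1 -> F,
  x = \sum_k c k *: delta_mx k.1 k.2.
Proof.
exists (fun k => x k.1 k.2); rewrite {1}[x]matrix_sum_delta.
by rewrite pair_bigA.
Qed.

Fact mat_orth (k l : 'I_s.+1 * 'I_s.+1) :
  mat_tr ((delta_mx k.1 k.2 : 'M[F]_s.+1)^T * delta_mx l.1 l.2) =
  if k == l then 1 / s.+1%:R else 0.
Proof.
case: k l => [k1 k2] [l1 l2] /=; rewrite trmx_delta xpair_eqE.
rewrite -[_ * _]/(delta_mx _ _ *m delta_mx _ _) mul_delta_mx_cond /mat_tr.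
case: eqP => [_|_] /=; last by rewrite mulr0n mxtrace0 mul0r.
rewrite mulr1n /mxtrace (bigD1 k2) //= mxE eqxx big1 ?addr0 => [|i ik].
  by case: (k2 == l2); rewrite ?mul0r.
by rewrite mxE (negPf ik).
Qed.

Section MatrixRepresentation.
Variables (K : fieldType) (iota : {rmorphism F -> K}).

Definition mat_rep : 'M[F]_s.+1 -> 'M[K]_s.+1 := map_mx iota.

Fact mat_rep_linear : linear_for (iota \; *:%R) mat_rep.
Proof. by move=> c x y; rewrite /mat_rep map_mxD map_mxZ. Qed.

Fact mat_rep_monoid : monoid_morphism mat_rep.
Proof. by split=> [|x y]; rewrite /mat_rep ?map_mx1 // map_mxM. Qed.

HB.instance Definition _ := GRing.isLinear.Build F M 'M[K]_s.+1
  (iota \; *:%R) mat_rep mat_rep_linear.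
HB.instance Definition _ := GRing.isMonoidMorphism.Build M 'M[K]_s.+1
  mat_rep mat_rep_monoid.

End MatrixRepresentation.

Definition pfister_mat : pfister M.
Proof.
apply: (@Pfister F M ('I_s.+1 * 'I_s.+1)%type (fun k => delta_mx k.1 k.2)
  (fun=> 1) s mat_tr mat_trL mat_tr_unique mat_span mat_orth).
- by move=> _; exact: oner_neq0.
- by move=> _; exists 1; rewrite /= trmx1 !mul1r scale1r.
- by move=> P; left=> _; exact: nonneg1.
- by move=> K iota; exists K, idfun, s, (mat_rep (ext_iota iota idfun)).
Qed.
End MatrixAlgebra.

Section QuaternionAlgebra.
Variables (F : fieldType) (Q : algInv F).
Hypothesis two0 : 2%:R != 0 :> F.
Variables (a b s t : F) (u v : Q).
Hypotheses (uvP : quat_basis a b u v) (s0 : s != 0) (t0 : t != 0).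
Hypotheses (su : inv Q u = s *: u) (sv : inv Q v = t *: v).

Let uu : u * u = a%:A. Proof. by case: uvP => _ _ []. Qed.
Let vv : v * v = b%:A. Proof. by case: uvP => _ _ []. Qed.
Let vu : v * u = - (u * v). Proof. by case: uvP => _ _ []. Qed.

Definition quat_vec (k : bool * bool) : Q :=
  (if k.1 then u else 1) * (if k.2 then v else 1).

Definition quat_coef (k : bool * bool) : F :=
  (if k.1 then s * a else 1) * (if k.2 then t * b else 1).

Lemma quat_vec_isometry k : inv Q (quat_vec k) * quat_vec k = (quat_coef k)%:A.
Proof.
case: k => k1 k2; rewrite /quat_vec /quat_coef invM -mulrA.
rewrite [_ * (_ * (if k2 then v else 1))]mulrA /=.
have -> : inv Q (if k1 then u else 1) * (if k1 then u else 1) =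
    (if k1 then s * a else 1)%:A.
  by case: k1; rewrite ?inv1 ?mul1r ?scale1r // su -scalerAl uu scalerA.
rewrite mulr_algl -scalerAr.
have -> : inv Q (if k2 then v else 1) * (if k2 then v else 1) =
    (if k2 then t * b else 1)%:A.
  by case: k2; rewrite ?inv1 ?mul1r ?scale1r // sv -scalerAl vv scalerA.
by rewrite scalerA.
Qed.

Lemma quat_vec_isometryr k : quat_vec k * inv Q (quat_vec k) = (quat_coef k)%:A.
Proof.
case: k => k1 k2; rewrite /quat_vec /quat_coef invM -mulrA.
rewrite [_ * (_ * inv Q (if k1 then u else 1))]mulrA /=.
have -> : (if k2 then v else 1) * inv Q (if k2 then v else 1) =
    (if k2 then t * b else 1)%:A.
  by case: k2; rewrite ?inv1 ?mul1r ?scale1r // sv -scalerAr vv scalerA.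
rewrite mulr_algl -scalerAr.
have -> : (if k1 then u else 1) * inv Q (if k1 then u else 1) =
    (if k1 then s * a else 1)%:A.
  by case: k1; rewrite ?inv1 ?mul1r ?scale1r // su -scalerAr uu scalerA.
by rewrite scalerA mulrC.
Qed.

Lemma quat_vecE k : quat_vec k =
  quat_of u v (~~ k.1 && ~~ k.2)%:R (k.1 && ~~ k.2)%:R
              (~~ k.1 && k.2)%:R (k.1 && k.2)%:R.
Proof.
by case: k => [[] []]; rewrite /quat_vec /quat_of /= ?mul1r ?mulr1
  ?scale1r ?scale0r ?add0r ?addr0.
Qed.

Fact quat_orth k l : quat_tr u v (inv Q (quat_vec k) * quat_vec l) =
  if k == l then quat_coef k / 1%:R else 0.
Proof.
case: eqP => [<-|kl].
  by rewrite quat_vec_isometry (quat_tr_scalar uvP) divr1.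
have sk : exists c, inv Q (quat_vec k) = c *: quat_vec k.
  case: k {kl} => [[] []]; rewrite /quat_vec /= ?mul1r ?mulr1 ?inv1.
  - exists (- (t * s)); rewrite invM su sv -scalerAl -scalerAr vu scalerA.
    by rewrite scalerN scaleNr.
  - by exists s.
  - by exists t.
  - by exists 1; rewrite scale1r.
have [c ->] := sk; rewrite -scalerAl /quat_tr quat_coordZ -/(quat_tr _ _ _).
rewrite !quat_vecE (quatM uu vv vu) (quat_tr_quat uvP).
by case: k l kl {sk} => [[] []] [[] []] //= _;
  rewrite !(mulr0, mul0r, addr0, subrr).
Qed.

Fact quat_span x : exists c : bool * bool -> F, x = \sum_k c k *: quat_vec k.
Proof.
pose c (e f : bool) := quat_coord u v (inord (e + f.*2)) x.
exists (fun k => c k.1 k.2).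
rewrite -(pair_bigA _ (fun e f => c e f *: quat_vec (e, f))).
rewrite big_bool !big_bool /quat_vec /c /= {1}(quatE uvP x) /quat_of.
rewrite ?mul1r ?mulr1 [RHS]addrC [X in _ = X + _]addrC [X in _ = _ + X]addrC.
by rewrite [RHS]addrACA addrA.
Qed.

Definition pfister_quat : pfister Q.
Proof.
have [a0 b0 _ _] := uvP.
have tL : linear (quat_tr u v : Q -> F^o).
  by move=> c x y; rewrite /quat_tr quat_coordD quat_coordZ.
apply: (@Pfister F Q (bool * bool)%type quat_vec quat_coef 0 (quat_tr u v)
  tL (quat_trace_unique uvP two0) quat_span quat_orth).
- by move=> [[] []]; rewrite /quat_coef /= !mulf_neq0 ?oner_neq0.
- by move=> k; exists (quat_vec k); rewrite quat_vec_isometry quat_vec_isometryr.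
- move=> P.
  (* The signature of the Pfister form [<1, s a> (x) <1, t b>]. *)
  have E : \sum_k ord_sign P (quat_coef k) =
      (1 + ord_sign P (s * a)) * (1 + ord_sign P (t * b)).
    rewrite -(pair_bigA _ (fun e f => ord_sign P (quat_coef (e, f)))).
    rewrite big_bool !big_bool.
    by rewrite /quat_coef /= ?mul1r ?mulr1 !ord_signM !ord_sign1; ring.
  have [Pa|Pa] := boolP (s * a \in nonneg P); last first.
    right; rewrite E [ord_sign P (s * a)]/ord_sign (negPf Pa) mulf_eq0.
    rewrite (negPf s0) (negPf a0).
    by rewrite /= subrr mul0r.
  have [Pb|Pb] := boolP (t * b \in nonneg P); last first.
    right; rewrite E [ord_sign P (t * b)]/ord_sign (negPf Pb) mulf_eq0.
    rewrite (negPf t0) (negPf b0).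
    by rewrite /= subrr mulr0.
  left=> [[k1 k2]]; rewrite /quat_coef nonnegM //=.
    by case: k1 => //; exact: nonneg1.
  by case: k2 => //; exact: nonneg1.
- move=> K iota; have [L [j [r rP]]] := sqrt_extension (iota a).
  exists L, j, 1%N, (@quat_representation F L Q (ext_iota iota j) a b u v uvP r rP).
  have bP : basis_of fullv [tuple 1; u; v; u * v] by case: uvP.
  by rewrite -dimvf (size_basis bP).
Qed.

End QuaternionAlgebra.

Lemma quaternion_pfister (F : fieldType) (Q : algInv F) : 2%:R != 0 :> F ->
  quaternion Q -> division_alg Q -> inhabited (pfister Q).
Proof.
move=> two0 Qq Qd; have [a [b [s [t [u [v [uvP s0 t0 su sv]]]]]]] :=
  adapted_quat_basis (inv Q) two0 Qq Qd.
by constructor; exact: (pfister_quat two0 uvP s0 t0 su sv).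
Qed.

Lemma linear_bij_dim (F : fieldType) (V W : vectType F) (f : {linear V -> W}) :
  bijective f -> dim V = dim W.
Proof.
move=> [g fK gK]; rewrite -!dimvf.
have ker0 : (fullv :&: lker (linfun f) = 0)%VS.
  rewrite capfv; apply/eqP/lker0P => x y; rewrite !lfunE /=.
  exact: can_inj fK x y.
rewrite -(limg_dim_eq ker0); congr (\dim _); apply/vspaceP => w.
by rewrite memvf -(gK w) -(lfunE f) memv_img ?memvf.
Qed.

Section Isomorphism.
Variables (F : fieldType) (X Y : algInv F) (pY : pfister Y).
Variables (f : {lrmorphism X -> Y}) (g : Y -> X).
Hypotheses (fK : cancel f g) (gK : cancel g f).
Hypothesis f_inv : forall x, f (inv X x) = inv Y (f x).

Let g_linear : linear g.
Proof.
by move=> c x y; apply: (can_inj fK); rewrite linearD linearZ /= !gK.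
Qed.

Let gM x y : g (x * y) = g x * g y.
Proof. by apply: (can_inj fK); rewrite rmorphM /= !gK. Qed.

Let gZ c : g c%:A = c%:A.
Proof. by apply: (can_inj fK); rewrite gK linearZ /= rmorph1. Qed.

Let g_inv y : g (inv Y y) = inv X (g y).
Proof. by apply: (can_inj fK); rewrite f_inv !gK. Qed.

Definition pfister_iso : pfister X.
Proof.
pose gL := GRing.isLinear.Build F Y X *:%R g g_linear.
pose g' : {linear Y -> X} := HB.pack g gL.
have gE y : g y = g' y by [].
have tL : linear ((fun x => pf_tr pY (f x)) : X -> F^o).
  by move=> c x y; rewrite linearP; exact: pf_trL.
have tU (V : zmodType) (h : {additive X -> V}) :
    (forall x y, h (x * y) = h (y * x)) ->
    forall x, h x = h (pf_tr pY (f x))%:A.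
  move=> hC x; have := @pf_tr_unique _ _ pY V (h \o g')%FUN.
  move=> /(_ _ (f x)) /=; rewrite fK gZ; apply => y z.
  by rewrite /= !gM hC.
have tS x : exists c : pf_index pY -> F, x = \sum_k c k *: g (pf_vec k).
  have [c E] := pf_span pY (f x); exists c.
  rewrite -[LHS]fK E gE linear_sum; apply: eq_bigr => k _.
  by rewrite linearZ.
apply: (@Pfister F X (pf_index pY) (fun k => g (pf_vec k)) (@pf_coef _ _ pY)
  (pf_deg pY) (fun x => pf_tr pY (f x)) tL tU tS).
- by move=> k l; rewrite rmorphM /= f_inv !gK pf_orth.
- exact: pf_coef_neq0.
- move=> k; have [y [E1 E2]] := pf_coef_mult k; exists (g y).
  by rewrite -g_inv -!gM E1 E2 gZ.
- exact: pf_ord_sign.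
- move=> K iota; have [L [j [n [phi dimY]]]] := pf_split pY iota.
  exists L, j, n, (phi \o f)%FUN; rewrite dimY; apply/esym.
  by apply: (linear_bij_dim (f := f)); exists g.
Qed.

End Isomorphism.

Section TensorProduct.
Variables (F : fieldType) (X Y : algInv F) (pX : pfister X) (pY : pfister Y).
Local Notation XY := (X (x) Y)%ALG.

Lemma ptensDl (x x' : X) (y : Y) : ptens (x + x') y = ptens x y + ptens x' y.
Proof. by have := ptens_linearl y 1 x x'; rewrite !scale1r. Qed.

Lemma ptensDr (x : X) (y y' : Y) : ptens x (y + y') = ptens x y + ptens x y'.
Proof. by have := ptens_linearr x 1 y y'; rewrite !scale1r. Qed.

Lemma ptensZl c (x : X) (y : Y) : ptens (c *: x) y = c *: ptens x y.
Proof. by rewrite /ptens linearZ /= [in LHS]linearZ /= -scalemxAl. Qed.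

Lemma ptensZr c (x : X) (y : Y) : ptens x (c *: y) = c *: ptens x y.
Proof. by rewrite /ptens linearZ /= scalemxAr. Qed.

Definition tens_tr : tens X Y -> F :=
  tlift (fun a b => pf_tr pX a * pf_tr pY b : F^o).

Lemma pf_trD (Z : algInv F) (p : pfister Z) x y :
  pf_tr p (x + y) = pf_tr p x + pf_tr p y.
Proof. by have := pf_trL p 1 x y; rewrite !scale1r. Qed.

Lemma pf_tr0 (Z : algInv F) (p : pfister Z) : pf_tr p 0 = 0.
Proof. by apply: (addIr (pf_tr p 0)); rewrite -pf_trD !add0r. Qed.

Lemma pf_trZ (Z : algInv F) (p : pfister Z) c x :
  pf_tr p (c *: x) = c * pf_tr p x.
Proof. by have := pf_trL p c x 0; rewrite pf_tr0 !addr0. Qed.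

Lemma tens_trE a b : tens_tr (ptens a b) = pf_tr pX a * pf_tr pY b.
Proof.
rewrite /tens_tr tlift_ptens // => [y|x] k u v.
  by rewrite pf_trD pf_trZ mulrDl -mulrA.
by rewrite pf_trD pf_trZ mulrDr mulrCA.
Qed.

Lemma tens_trL : linear (tens_tr : XY -> F^o).
Proof. exact: tlift_linear. Qed.

(** Commutators with elements of one factor reduce [a (x) b] to
    [tr(a) (x) b = 1 (x) tr(a)b], and then to a scalar. *)
Fact tens_tr_unique (V : zmodType) (f : {additive XY -> V}) :
  (forall x y, f (x * y) = f (y * x)) -> forall x, f x = f (tens_tr x)%:A.
Proof.
move=> fC; elim/tens_ind => [a b|x y IH IH']; last first.
  have := tens_trL 1 x y; rewrite !scale1r => ->.
  by rewrite scalerDl !raddfD IH IH'.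
have fl_add c : zmod_morphism (fun x : X => f (ptens x c : XY)).
  by move=> x y; rewrite -raddfB -scaleN1r ptensDl ptensZl scaleN1r.
have fr_add c : zmod_morphism (fun y : Y => f (ptens c y : XY)).
  by move=> x y; rewrite -raddfB -scaleN1r ptensDr ptensZr scaleN1r.
pose flA c := GRing.isZmodMorphism.Build X V _ (fl_add c).
pose fl c : {additive X -> V} := HB.pack (fun x : X => f (ptens x c : XY)) (flA c).
pose frA c := GRing.isZmodMorphism.Build Y V _ (fr_add c).
pose fr c : {additive Y -> V} := HB.pack (fun y : Y => f (ptens c y : XY)) (frA c).
have flC c x y : fl c (x * y) = fl c (y * x).
  have := fC (ptens x 1) (ptens y c); have := fC (ptens x c) (ptens y 1).
  by rewrite !tensM !mul1r !mulr1 /= => -> .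
have frC x y : fr 1 (x * y) = fr 1 (y * x).
  by have := fC (ptens 1 x) (ptens 1 y); rewrite !tensM !mul1r.
have /= -> := pf_tr_unique pX (flC b) a.
rewrite ptensZl -ptensZr.
have /= -> := pf_tr_unique pY frC (pf_tr pX a *: b).
by rewrite tens_trE pf_trZ ptensZr -tens1.
Qed.

Fact tens_span x : exists c : pf_index pX * pf_index pY -> F,
  x = \sum_k c k *: ptens (pf_vec k.1) (pf_vec k.2).
Proof.
elim/tens_ind: x => [a b|x y [c ->] [d ->]]; last first.
  exists (fun k => c k + d k); rewrite -big_split; apply: eq_bigr => k _.
  by rewrite scalerDl.
have [[c ->] [d ->]] := (pf_span pX a, pf_span pY b).
exists (fun k => c k.1 * d k.2).
rewrite -(pair_bigA _ (fun k l => (c k * d l) *: ptens (pf_vec k) (pf_vec l))).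
rewrite (big_morph (fun x => ptens x _) (fun x y => ptensDl x y _)
  (id1 := 0)); last first.
  by rewrite -(scale0r 0) ptensZl scale0r.
apply: eq_bigr => k _; rewrite (big_morph _ (ptensDr _) (id1 := 0)); last first.
  by rewrite -(scale0r 0) ptensZr scale0r.
by apply: eq_bigr => l _; rewrite ptensZl ptensZr scalerA.
Qed.

(** The coefficients of the product are products of coefficients, so that the
    sum of signs is the product of the sums of signs. *)
Definition pfister_tens : pfister XY.
Proof.
apply: (@Pfister F XY (pf_index pX * pf_index pY)%type
  (fun k => ptens (pf_vec k.1) (pf_vec k.2))
  (fun k => pf_coef k.1 * pf_coef k.2)
  ((pf_deg pX).+1 * (pf_deg pY).+1).-1 tens_tr tens_trL tens_tr_unique tens_span).
- move=> [k k'] [l l'] /=; rewrite tens_invE tensM tens_trE !pf_orth xpair_eqE.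
  case: (k == l); last by rewrite mul0r.
  case: (k' == l'); last by rewrite mulr0.
  by rewrite mulf_div -natrM.
- by move=> k; rewrite mulf_neq0 ?pf_coef_neq0.
- move=> k; have [x [E1 E2]] := pf_coef_mult k.1.
  have [y [E3 E4]] := pf_coef_mult k.2; exists (ptens x y).
  by rewrite /= tens_invE !tensM E1 E2 E3 E4 ptensZl ptensZr scalerA -tens1.
- move=> P.
  have E : \sum_(k : pf_index pX * pf_index pY)
      ord_sign P (pf_coef k.1 * pf_coef k.2) =
      (\sum_(k : pf_index pX) ord_sign P (pf_coef k)) *
      (\sum_(l : pf_index pY) ord_sign P (pf_coef l)).
    rewrite -(pair_bigA _ (fun (k : pf_index pX) (l : pf_index pY) =>
      ord_sign P (pf_coef k * pf_coef l))).
    rewrite big_distrl; apply: eq_bigr => k _; rewrite big_distrr.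
    by apply: eq_bigr => l _; rewrite ord_signM.
  have [pos|bal] := pf_ord_sign pX P; last by right; rewrite E bal mul0r.
  have [pos'|bal] := pf_ord_sign pY P; last by right; rewrite E bal mulr0.
  by left=> k; rewrite nonnegM.
- move=> K iota; have [L1 [j1 [n1 [phi1 d1]]]] := pf_split pX iota.
  have [L2 [j2 [n2 [phi2 d2]]]] := pf_split pY (ext_iota iota j1).
  exists L2, (j2 \o j1)%FUN, (tens_rep_size n1 n2).
  exists (tens_representation (ext_representation j2 phi1) phi2).
  by rewrite -[LHS]/(((n1.+1 * n2.+1) ^ 2)%N) expnMn d1 d2.
Qed.

End TensorProduct.

Lemma decomposable_pfister (F : fieldType) (X : algInv F) :
  (forall n, n.+1%:R != 0 :> F) -> decomposable X -> inhabited (pfister X).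
Proof.
move=> char0 [r [Q [s [QP [f [[g fK gK] f_inv]]]]]].
suff [pY] : inhabited (pfister (\big[@tensor F/mat_inv F s]_(i < r) Q i)).
  by constructor; exact: (pfister_iso pY fK gK f_inv).
apply: (big_rec (fun Y => inhabited (pfister Y))).
  by constructor; exact: pfister_mat.
move=> i Y _ [pY]; have [Qq Qd] := QP i.
have [pQ] := quaternion_pfister (char0 1%N) Qq Qd.
by constructor; exact: pfister_tens pQ pY.
Qed.

(** * The reduced trace *)

Section ReducedTrace.
Variables (F : fieldType) (X : algInv F) (p : pfister X).
Hypothesis char0 : forall n, n.+1%:R != 0 :> F.

Definition pf_weight (k : pf_index p) : F := pf_coef k / (pf_deg p).+1%:R.

Lemma pf_weight_neq0 k : pf_weight k != 0.
Proof. by rewrite mulf_neq0 ?invr_eq0 ?pf_coef_neq0. Qed.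

Definition pf_coord (x : X) (k : pf_index p) : F :=
  pf_tr p (inv X (pf_vec k) * x) / pf_weight k.

Lemma pf_tr_sum (I : finType) (f : I -> X) :
  pf_tr p (\sum_i f i) = \sum_i pf_tr p (f i).
Proof. exact: (big_morph _ (pf_trD p) (pf_tr0 p)). Qed.

Lemma pf_coord_sum (c : pf_index p -> F) k :
  pf_coord (\sum_l c l *: pf_vec l) k = c k.
Proof.
rewrite /pf_coord mulr_sumr pf_tr_sum (bigD1 k) //= big1 ?addr0 => [|l lk].
  by rewrite -scalerAr pf_trZ pf_orth eqxx mulfK ?pf_weight_neq0.
by rewrite -scalerAr pf_trZ pf_orth eq_sym (negPf lk) mulr0.
Qed.

Lemma pf_coordE x : x = \sum_k pf_coord x k *: pf_vec k.
Proof.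
have [c ->] := pf_span p x.
by apply: eq_bigr => k _; rewrite pf_coord_sum.
Qed.

Lemma pf_coordP c x y k : pf_coord (c *: x + y) k = c * pf_coord x k + pf_coord y k.
Proof.
by rewrite /pf_coord mulrDr -scalerAr pf_trD pf_trZ mulrDl -mulrA.
Qed.

Lemma pf_bilin x y : pf_tr p (inv X x * y) =
  \sum_k pf_weight k * pf_coord x k * pf_coord y k.
Proof.
rewrite {1}(pf_coordE x) linear_sum mulr_suml pf_tr_sum; apply: eq_bigr => k _.
rewrite linearZ -scalerAl pf_trZ [pf_coord y k]/pf_coord.
by field; rewrite pf_weight_neq0.
Qed.

Definition pf_row (x : X) : 'rV[F]_#|pf_index p| :=
  \row_i pf_coord x (enum_val i).

Fact pf_row_linear : linear pf_row.
Proof. by move=> c x y; apply/rowP => i; rewrite !mxE pf_coordP. Qed.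

HB.instance Definition _ := GRing.isLinear.Build F X 'rV[F]_#|pf_index p| *:%R
  pf_row pf_row_linear.

Definition pf_unrow (v : 'rV[F]_#|pf_index p|) : X :=
  \sum_k v 0 (enum_rank k) *: pf_vec k.

Lemma pf_rowK : cancel pf_row pf_unrow.
Proof.
move=> x; rewrite [RHS]pf_coordE; apply: eq_bigr => k _.
by rewrite mxE enum_rankK.
Qed.

Lemma pf_unrowK : cancel pf_unrow pf_row.
Proof. by move=> v; apply/rowP => i; rewrite mxE pf_coord_sum enum_valK. Qed.

Lemma card_pf_index : #|pf_index p| = dim X.
Proof.
have bij : bijective pf_row by exists pf_unrow; [exact: pf_rowK|exact: pf_unrowK].
by rewrite (linear_bij_dim bij) /dim /= mul1n.
Qed.

Section Splitting.
Variables (K : fieldType) (iota : {rmorphism F -> K}) (n : nat).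
Variable phi : {lrmorphism X -> 'M[K]_n.+1 | iota \; *:%R}.

(** The trace of a representation is a functional vanishing on commutators. *)
Lemma rep_trace x : \tr (phi x) = iota (pf_tr p x * n.+1%:R).
Proof.
pose f : {additive X -> K} := (@mxtrace K n.+1 \o phi)%FUN.
have fC a b : f (a * b) = f (b * a).
  by rewrite /f /= !rmorphM; exact: mxtrace_mulC.
have /= -> := pf_tr_unique p fC x.
by rewrite linearZ /= rmorph1 mxtraceZ mxtrace1 rmorphM rmorph_nat.
Qed.

Lemma splitting_size : splitting phi -> (n.+1 ^ 2)%N = dim X.
Proof. by move=> /size_basis; rewrite !dimvf => <-. Qed.

(** Linear independence over [K], and not only over [F]: the Gram matrix of the
    images under the trace form is the image of an invertible diagonal matrix. *)
Lemma rep_free : free [tuple phi (pf_vec (enum_val i)) | i < #|pf_index p|].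
Proof.
apply/freeP => k; under eq_bigr do rewrite -tnth_nth tnth_mktuple.
move=> E i; pose l := enum_val i.
have := congr1 (fun M => \tr (phi (inv X (pf_vec l)) * M)) E.
rewrite mulr0 mxtrace0 mulr_sumr raddf_sum (bigD1 i) //= big1 ?addr0.
  rewrite -scalerAr -rmorphM mxtraceZ rep_trace pf_orth eqxx => /eqP.
  by rewrite mulf_eq0 fmorph_eq0 !mulf_eq0 invr_eq0 !(negPf (char0 _))
    (negPf (pf_coef_neq0 _)) /= !orbF => /eqP.
move=> j ji; rewrite -scalerAr -rmorphM mxtraceZ rep_trace pf_orth.
by rewrite (inj_eq enum_val_inj) eq_sym (negPf ji) mul0r rmorph0 mulr0.
Qed.

(** By their number, the independent images of [pf_vec] span all matrices; they
    lie in the span of the images of any other basis. *)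
Lemma rep_splitting : (n.+1 ^ 2)%N = dim X -> splitting phi.
Proof.
move=> nX; pose S := [tuple of map phi (vbasis {:X})].
pose E := [tuple phi (pf_vec (enum_val i)) | i < #|pf_index p|].
have phiS x : phi x \in <<S>>%VS.
  rewrite (coord_vbasis (memvf x)) linear_sum rpred_sum // => i _.
  rewrite linearZ rpredZ // memv_span // map_f // mem_nth //.
  by rewrite size_tuple.
have dimM : \dim {: 'M[K]_n.+1} = dim X by rewrite -nX dimvf.
have fullS : (fullv <= <<S>>)%VS.
  have ES : (<<E>> <= <<S>>)%VS.
    by apply/span_subvP => _ /tnthP [i ->]; rewrite tnth_mktuple phiS.
  rewrite -(geq_leqif (dimv_leqif_sup _)) ?subvf //.
  rewrite dimM -card_pf_index -(size_tuple E) -(eqP rep_free).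
  exact: dimvS.
change (basis_of fullv S); rewrite basisEdim fullS size_tuple dimM.
by rewrite dimvf leqnn.
Qed.

End Splitting.

(** The degree of a splitting is determined by the dimension of the algebra, so
    all splittings give the same trace. *)
Lemma Trd_pf : exists n : nat, forall x, Trd x = pf_tr p x * n.+1%:R.
Proof.
have [L [j [n [phi nX]]]] := pf_split p (idfun : {rmorphism F -> F}).
exists n => x; apply: xget_unique.
  exists L, (ext_iota idfun j), n, phi; split; first exact: rep_splitting.
  by rewrite rep_trace.
move=> t [K [iota [m [psi [/splitting_size mX E]]]]].
apply: (fmorph_inj iota); rewrite E rep_trace; congr (iota (_ * _.+1%:R)).
by move: mX; rewrite -nX => /eqP; rewrite eqn_sqr => /eqP [].
Qed.

End ReducedTrace.

(** * The involution trace form *)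

Section TraceForm.
Variables (F : fieldType) (X : algInv F) (p : pfister X).
Hypothesis char0 : forall n, n.+1%:R != 0 :> F.
Variable d : nat.
Hypothesis TrdE : forall x : X, Trd x = pf_tr p x * d.+1%:R.
Local Notation T := (@trace_form F X).

Definition tf_coef (k : pf_index p) : F := pf_weight k * d.+1%:R.

Lemma tf_coef_neq0 k : tf_coef k != 0.
Proof. by rewrite mulf_neq0 ?(pf_weight_neq0 char0). Qed.

Lemma ord_sign_tf_coef P k : ord_sign P (tf_coef k) = ord_sign P (pf_coef k).
Proof.
rewrite /tf_coef /pf_weight !ord_signM [ord_sign P _^-1]ord_sign_pos;
  rewrite ?invr_eq0 //; last first.
  by rewrite nonnegV ?nonneg_nat.
by rewrite [ord_sign P d.+1%:R]ord_sign_pos ?nonneg_nat // !mulr1.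
Qed.

Lemma tf_coef_nonneg P k : pf_coef k \in nonneg P -> tf_coef k \in nonneg P.
Proof. by move=> Pk; rewrite !nonnegM ?nonnegV ?nonneg_nat. Qed.

Definition tf_polar (x y : X) : F := Trd (inv X x * y).

Lemma tf_polarE x y :
  tf_polar x y = \sum_k tf_coef k * pf_coord x k * pf_coord y k.
Proof.
rewrite /tf_polar TrdE (pf_bilin _ char0) mulr_suml; apply: eq_bigr => k _.
by rewrite /tf_coef; ring.
Qed.

Lemma tf_polarC x y : tf_polar x y = tf_polar y x.
Proof. by rewrite !tf_polarE; apply: eq_bigr => k _; ring. Qed.

Lemma TrdD x y : Trd (x + y : X) = Trd x + Trd y.
Proof. by rewrite !TrdE pf_trD mulrDl. Qed.

Lemma Trd0 : Trd (0 : X) = 0.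
Proof. by rewrite TrdE pf_tr0 mul0r. Qed.

Lemma Trd_sum (I : finType) (f : I -> X) : Trd (\sum_i f i) = \sum_i Trd (f i).
Proof. exact: (big_morph _ TrdD Trd0). Qed.

Lemma trace_formE x : T x = \sum_k tf_coef k * pf_coord x k ^+ 2.
Proof.
by rewrite -[T x]/(tf_polar x x) tf_polarE; apply: eq_bigr => k _; ring.
Qed.

Lemma trace_form_isometric :
  isometric T (diag_form (fun i : 'I_#|pf_index p| => tf_coef (enum_val i))).
Proof.
exists (pf_row p); split.
  by exists (@pf_unrow _ _ p); [exact: pf_rowK|exact: pf_unrowK].
move=> x; rewrite trace_formE /diag_form.
rewrite [RHS](reindex _ (onW_bij _ (enum_val_bij (pf_index p)))) /=.
by apply: eq_bigr => i _; rewrite mxE.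
Qed.

Lemma trace_form_signature P :
  signature P T = \sum_k ord_sign P (pf_coef (p := p) k).
Proof.
rewrite (signature_diag P trace_form_isometric).
rewrite [RHS](reindex _ (onW_bij _ (enum_val_bij (pf_index p)))) /=.
by apply: eq_bigr => i _; rewrite ord_sign_tf_coef.
Qed.

Lemma isotropic_trace_form : inv_weakly_isotropic X -> weakly_isotropic T.
Proof.
move=> [n [x [x0 xs]]]; exists n, [ffun i => x i].
  apply: contra_neq (x0 ord0) => /ffunP/(_ ord0).
  by rewrite !ffunE.
rewrite /ntimes; under eq_bigr do rewrite ffunE.
by rewrite -(Trd_sum (fun i => inv X (x i) * x i)) xs Trd0.
Qed.

Lemma hyperbolic_trace_form : weakly_hyperbolic T -> weakly_isotropic T.
Proof.
move=> [n [m [f [[g fK gK] fq]]]]; exists n.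
have f0 : f 0 = 0 by exact: linear0.
case: m f g fK gK fq f0 => [|m] f g fK gK fq f0.
  have /(congr1 f) : [ffun=> 1] = 0 :> {ffun 'I_n.+1 -> X}.
    by apply: (can_inj fK); rewrite [LHS]surjective_pairing
      [RHS]surjective_pairing !(thinmx0 _.1) !(thinmx0 _.2).
  move=> /(can_inj fK)/ffunP/(_ ord0); rewrite !ffunE => /eqP.
  by rewrite (negPf (oner_neq0 _)).
exists (g (const_mx 1, 0)).
  apply/eqP => /(congr1 f); rewrite gK f0 => -[] /rowP/(_ ord0).
  by rewrite !mxE => /eqP; rewrite (negPf (oner_neq0 _)).
by rewrite -fq gK /hyp_form big1 // => i _; rewrite !mxE mulr0.
Qed.

(** If all coefficients are positive at [P], then so is every multiple of the
    form on nonzero vectors; otherwise the signs of the coefficients cancel. *)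
Lemma isotropic_signature : weakly_isotropic T ->
  forall P : ordering F, signature P T = 0.
Proof.
move=> [n [v v0 vs]] P; rewrite trace_form_signature.
have [pos|//] := pf_ord_sign p P; case/negP: v0; apply/eqP/ffunP => i.
have Tpos x : T x \in nonneg P.
  rewrite trace_formE nonneg_sum // => k _.
  by rewrite nonnegM ?nonneg_sq ?tf_coef_nonneg.
have := nonneg_sum_eq0 (fun j => Tpos (v j)) vs i.
rewrite trace_formE ffunE => /nonneg_sum_eq0 H.
rewrite (pf_coordE p char0 (v i)) big1 // => k _.
have /eqP : tf_coef k * pf_coord (v i) k ^+ 2 = 0.
  by apply: (H P) => l; rewrite nonnegM ?nonneg_sq ?tf_coef_nonneg.
by rewrite mulf_eq0 (negPf (tf_coef_neq0 _)) sqrf_eq0 => /eqP ->; rewrite scale0r.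
Qed.

(** An ordering containing all multipliers would make the trace form positive
    definite. *)
Lemma signature_multiplier : (forall P : ordering F, signature P T = 0) ->
  multiplier (inv X) (-1).
Proof.
move=> sig0; apply: contrapT => /multiplier_preordering.
move=> /preordering_extends [P mP].
have pos (k : pf_index p) : pf_coef k \in nonneg P.
  by apply: mP; have [g [E1 E2]] := pf_coef_mult k; exact: multiplier_elt E1 E2.
have := sig0 P; rewrite trace_form_signature.
under eq_bigr do rewrite ord_sign_pos ?pf_coef_neq0 //.
rewrite sumr_const => /eqP; rewrite pnatr_eq0 => /eqP I0.
have := oner_neq0 X; rewrite (pf_coordE p char0 1) big1 ?eqxx // => k _.
by have := card0_eq I0 k.
Qed.

Section Hyperbolic.
Variables (n : nat) (W : 'M[X]_n.+1).
Hypothesis sW : similitude (inv X) (-1) W.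
Local Notation V := {ffun 'I_(n.+1 + n.+1) -> X}.
Local Notation C := 'cV[X]_n.+1.

Definition up (v : V) : C := \col_i v (lshift n.+1 i).
Definition down (v : V) : C := \col_i v (rshift n.+1 i).
Definition glue (x y : C) : V :=
  [ffun i => match split i with inl k => x k 0 | inr k => y k 0 end].

Lemma up_glue x y : up (glue x y) = x.
Proof.
by apply/colP => i; rewrite mxE ffunE (unsplitK (inl i)).
Qed.

Lemma down_glue x y : down (glue x y) = y.
Proof.
by apply/colP => i; rewrite mxE ffunE (unsplitK (inr i)).
Qed.

Lemma glueK v : glue (up v) (down v) = v.
Proof.
by apply/ffunP => i; rewrite ffunE; case: splitP => k ik; rewrite mxE;
  congr (v _); apply: val_inj; rewrite /= ik.
Qed.

Definition col_polar (x y : C) : F := \sum_i tf_polar (x i 0) (y i 0).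

Lemma col_polarE x y : col_polar x y = Trd ((adj (inv X) x *m y) 0 0).
Proof. by rewrite mxE Trd_sum; apply: eq_bigr => i _; rewrite !mxE. Qed.

Lemma col_polarC x y : col_polar x y = col_polar y x.
Proof. by apply: eq_bigr => i _; exact: tf_polarC. Qed.

Lemma col_polarDr x y z : col_polar x (y + z) = col_polar x y + col_polar x z.
Proof. by rewrite !col_polarE mulmxDr mxE TrdD. Qed.

Lemma col_polarNr x y : col_polar x (- y) = - col_polar x y.
Proof.
apply: (addIr (col_polar x y)); rewrite -col_polarDr !addNr.
by rewrite col_polarE mulmx0 mxE Trd0.
Qed.

Lemma col_polarW y : col_polar (W *m y) (W *m y) = - col_polar y y.
Proof.
rewrite !col_polarE adjM -mulmxA (similitudeKl _ sW) scaleN1r scaleN1r mulmxN.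
by rewrite -[in RHS]col_polarE -col_polarNr col_polarE mulmxN.
Qed.

Definition minus (v : V) : C := up v - W *m down v.
Definition plus (v : V) : C := up v + W *m down v.

(** As [W] is an anti-isometry, [q(x) + q(y) = q(x) - q(W y)] is a difference of
    two squares. *)
Lemma ntimes_trace_form (v : V) : ntimes T v = col_polar (minus v) (plus v).
Proof.
have -> : ntimes T v = col_polar (up v) (up v) + col_polar (down v) (down v).
  by rewrite /ntimes big_split_ord /=; congr (_ + _); apply: eq_bigr => i _;
    rewrite /tf_polar !mxE.
rewrite /minus /plus; move: (up v) (down v) => x y.
rewrite !col_polarDr ![col_polar (x - _) _]col_polarC !(col_polarDr, col_polarNr).
rewrite col_polarW opprK [col_polar (W *m y) x]col_polarC.
by ring.
Qed.

Lemma up_linear c u v : up (c *: u + v) = c%:A *: up u + up v.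
Proof. by apply/colP => i; rewrite !mxE !ffunE mulr_algl. Qed.

Lemma down_linear c u v : down (c *: u + v) = c%:A *: down u + down v.
Proof. by apply/colP => i; rewrite !mxE !ffunE mulr_algl. Qed.

Lemma minus_linear c u v : minus (c *: u + v) = c%:A *: minus u + minus v.
Proof.
rewrite /minus up_linear down_linear mulmxDr mulmx_algZr scalerBr opprD.
by rewrite addrACA.
Qed.

Lemma plus_linear c u v : plus (c *: u + v) = c%:A *: plus u + plus v.
Proof.
by rewrite /plus up_linear down_linear mulmxDr mulmx_algZr scalerDr addrACA.
Qed.

(** The inverse of [v |-> (minus v, plus v)], where [W^-1 = - W^*]. *)
Definition unhyp (z z' : C) : V :=
  glue (2^-1%:A *: (z + z')) (- (adj (inv X) W *m (2^-1%:A *: (z' - z)))).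

Lemma halfK (z : C) : 2^-1%:A *: (z + z) = z.
Proof.
rewrite -[in X in X + X](scale1r z) -scalerDl scalerA mulr_algl -mulr2n.
by rewrite -scaler_nat scalerA mulVf ?(char0 1) // !scale1r.
Qed.

Lemma W_unhyp z z' : W *m down (unhyp z z') = 2^-1%:A *: (z' - z).
Proof.
by rewrite down_glue mulmxN (similitudeKr _ sW) !scaleN1r opprK.
Qed.

Lemma minus_unhyp z z' : minus (unhyp z z') = z.
Proof.
by rewrite /minus W_unhyp up_glue -scalerBr opprB addrACA subrr addr0 halfK.
Qed.

Lemma plus_unhyp z z' : plus (unhyp z z') = z'.
Proof.
by rewrite /plus W_unhyp up_glue -scalerDr [z + z']addrC addrACA subrr addr0 halfK.
Qed.

Lemma unhyp_minus_plus v : unhyp (minus v) (plus v) = v.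
Proof.
rewrite /unhyp /minus /plus -[RHS]glueK; congr glue.
  by rewrite addrACA addNr addr0 halfK.
rewrite opprB [up v + _]addrC addrACA subrr addr0 halfK.
by rewrite (similitudeKl _ sW) !scaleN1r opprK.
Qed.

Definition hyp_index : finType := ('I_n.+1 * pf_index p)%type.
Local Notation H := 'rV[F]_#|hyp_index|.

(** The coordinates of [minus v] and [plus v], the latter scaled by the
    coefficients of the trace form, turn [col_polar] into a sum of hyperbolic
    planes. *)
Definition hyp_row (v : V) : H * H :=
  (\row_j pf_coord (minus v (enum_val j).1 0) (enum_val j).2,
   \row_j (tf_coef (enum_val j).2 *
           pf_coord (plus v (enum_val j).1 0) (enum_val j).2)).

Fact hyp_row_linear : linear hyp_row.
Proof.
move=> c u v; rewrite /hyp_row minus_linear plus_linear.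
congr (_, _); apply/rowP => j; rewrite !mxE mulr_algl pf_coordP //.
by ring.
Qed.

HB.instance Definition _ := GRing.isLinear.Build F V (H * H)%type *:%R
  hyp_row hyp_row_linear.

Definition col_of (c : 'I_n.+1 -> pf_index p -> F) : C :=
  \col_i \sum_k c i k *: pf_vec k.

Lemma col_of_coord (z : C) : col_of (fun i k => pf_coord (z i 0) k) = z.
Proof. by apply/colP => i; rewrite mxE -(pf_coordE p char0). Qed.

Lemma coord_col_of c i k : pf_coord (col_of c i 0) k = c i k.
Proof. by rewrite mxE pf_coord_sum. Qed.

Definition hyp_unrow (r : H * H) : V :=
  unhyp (col_of (fun i k => r.1 0 (enum_rank ((i, k) : hyp_index))))
    (col_of (fun i k => r.2 0 (enum_rank ((i, k) : hyp_index)) / tf_coef k)).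

Lemma hyp_rowK : cancel hyp_row hyp_unrow.
Proof.
move=> v; rewrite -[RHS]unhyp_minus_plus -[in RHS](col_of_coord (minus v)).
rewrite -[in RHS](col_of_coord (plus v)) /hyp_unrow.
have E1 i k : (hyp_row v).1 0 (enum_rank ((i, k) : hyp_index)) =
    pf_coord (minus v i 0) k.
  by rewrite mxE enum_rankK.
have E2 i k : (hyp_row v).2 0 (enum_rank ((i, k) : hyp_index)) / tf_coef k =
    pf_coord (plus v i 0) k.
  by rewrite mxE enum_rankK mulrAC divff ?tf_coef_neq0 // mul1r.
have col_ext c c' : (forall i k, c i k = c' i k) -> col_of c = col_of c'.
  by move=> E; apply/colP => i; rewrite !mxE; apply: eq_bigr => k _; rewrite E.
by rewrite (col_ext _ _ E1) (col_ext _ _ E2).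
Qed.

Lemma hyp_unrowK : cancel hyp_unrow hyp_row.
Proof.
move=> [r r']; rewrite /hyp_row /hyp_unrow minus_unhyp plus_unhyp.
congr (_, _); apply/rowP => j;
  rewrite mxE coord_col_of -surjective_pairing enum_valK //.
by rewrite mulrC divfK ?tf_coef_neq0.
Qed.

Lemma ntimes_trace_form_hyperbolic :
  isometric (@ntimes F X (n.+1 + n.+1) T) (@hyp_form F #|hyp_index|).
Proof.
exists hyp_row; split.
  by exists hyp_unrow; [exact: hyp_rowK|exact: hyp_unrowK].
move=> v; rewrite ntimes_trace_form /hyp_form /col_polar.
under [RHS]eq_bigr do rewrite tf_polarE.
rewrite pair_bigA [RHS](reindex _ (onW_bij _ (enum_val_bij hyp_index))) /=.
by apply: eq_bigr => j _; rewrite !mxE; ring.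
Qed.

End Hyperbolic.

Lemma multiplier_weakly_hyperbolic_form :
  multiplier (inv X) (-1) -> weakly_hyperbolic T.
Proof.
move=> /multiplier_pos [n [W sW]]; exists (n + n.+1)%N.
by exists #|hyp_index n|; exact: ntimes_trace_form_hyperbolic sW.
Qed.

End TraceForm.

(** * The equivalence *)

Lemma formally_real_char0 (F : fieldType) :
  formally_real F -> forall n, n.+1%:R != 0 :> F.
Proof.
move=> F_real n; apply: contraNneq (F_real (nseq n 1)) => n0.
rewrite big_nseq expr1n -[iter _ _ _]/(iter n (+%R 1) 0) -addr_eq0.
suff -> : iter n (+%R 1) 0 = n%:R :> F by rewrite -mulrSr n0.
by elim: n {n0} => //= n ->; rewrite -mulrS.
Qed.

Theorem proposition3p1 (F : fieldType) (A : falgType F) (sigma : involution A)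
    (F_real : formally_real F) (A_cs : central_simple A)
    (A_dec : decomposable (AlgInv sigma)) :
  let T := @trace_form F (AlgInv sigma) in
  [<-> inv_weakly_isotropic (AlgInv sigma);
       inv_weakly_hyperbolic (AlgInv sigma);
       weakly_isotropic T;
       weakly_hyperbolic T;
       forall P : ordering F, inv_signature P (AlgInv sigma) = 0;
       forall P : ordering F, signature P T = 0].
Proof.
move=> T; have char0 := formally_real_char0 F_real.
have [p] := decomposable_pfister char0 A_dec.
have [d TrdE] := Trd_pf p char0.
have iso_mult : weakly_isotropic T -> multiplier (inv (AlgInv sigma)) (-1).
  move=> /(isotropic_signature char0 TrdE).
  exact (signature_multiplier char0 TrdE).
have sqrt0 P : inv_signature P (AlgInv sigma) = 0 <-> signature P T = 0.
  rewrite /inv_signature; split=> [/eqP|->]; last by rewrite sqrtC0.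
  by rewrite sqrtC_eq0 intr_eq0 => /eqP.
tfae.
- move=> /(isotropic_trace_form TrdE)/iso_mult.
  exact: (multiplier_weakly_hyperbolic (X := AlgInv sigma) (char0 1%N)).
- by move=> /weakly_hyperbolic_isotropic/(isotropic_trace_form TrdE).
- move=> /iso_mult; exact (multiplier_weakly_hyperbolic_form char0 TrdE).
- move=> /hyperbolic_trace_form/(isotropic_signature char0 TrdE) sig0 P.
  exact/sqrt0.
- by move=> sig0 P; apply/sqrt0.
- move=> /(signature_multiplier char0 TrdE) m.
  exact: (weakly_hyperbolic_isotropic (X := AlgInv sigma)
    (multiplier_weakly_hyperbolic (char0 1%N) m)).
Qed.
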